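(* Let $d\neq 0$ be a real number, $s_d\in\mathbb{N}_{\mathrm{Sh}}$, and let $f:X_3\to X_3$ be a continuous map of a $3$-star $X_3$. Then there exists a map $F\in\mathcal{L}_1(S)$ such that $\mathrm{Rot}_{\mathbb{R}}(F)=\mathrm{Rot}(F)$ is the closed interval with endpoints $0$ and $d$, $\mathrm{Per}(0,F)=\mathrm{Per}^{\circ}(f)$, and $$\mathrm{Per}(F)=\mathrm{Per}^{\circ}(f)\cup M(\min\{0,d\},\max\{0,d\})\cup\Lambda(d,\mathrm{Sh}(s_d)).$$
   Context: $\mathbb{N}=\{1,2,3,\dots\}$. $S=\mathbb{R}\cup B\subset\mathbb{C}$, where $B=\{z\in\mathbb{C}:\mathrm{Re}(z)\in\mathbb{Z},\ \mathrm{Im}(z)\in[0,1]\}$ and $\mathbb{R}$ is the real axis. $\mathcal{L}_1(S)$ is the set of continuous maps $F:S\to S$ with $F(z+1)=F(z)+1$ for all $z\in S$. A point $z\in S$ is periodic (mod 1) for $F$ if $F^n(z)\in z+\mathbb{Z}$ for some $n\in\mathbb{N}$; the least such $n$ is its period (mod 1). $\mathrm{Per}(F)$ is the set of periods (mod 1) of all periodic (mod 1) points of $F$. The rotation number of $z\in S$ is $\rho_F(z)=\lim_{n\to\infty}\frac{\mathrm{Re}(F^n(z))-\mathrm{Re}(z)}{n}$ when the limit exists; $\mathrm{Rot}(F)=\{\rho_F(z):z\in S\}$ and $\mathrm{Rot}_{\mathbb{R}}(F)=\{\rho_F(z):z\in\mathbb{R}\}$ (over points for which the limit exists). $\mathrm{Per}(\alpha,F)$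 is the set of periods (mod 1) of all periodic (mod 1) points of $F$ with rotation number $\alpha$. A $3$-star $X_3$ is a union of three segments (spaces homeomorphic to $[0,1]$) glued together at one common endpoint, which is their only common point (a space shaped like the letter $Y$). For a map $f:X\to X$, $\mathrm{Per}^{\circ}(f)$ is the set of $n\in\mathbb{N}$ such that there is $x\in X$ with $f^n(x)=x$ and $f^i(x)\ne x$ for $1\le i\le n-1$. $\mathbb{N}_{\mathrm{Sh}}=\mathbb{N}\cup\{2^\infty\}$ is totally ordered by the Sharkovsky ordering: $3>5>7>\cdots>2\cdot3>2\cdot5>2\cdot7>\cdots>2^2\cdot3>2^2\cdot5>\cdots>2^\infty>\cdots>2^n>\cdots>2^2>2>1$. For $s\in\mathbb{N}_{\mathrm{Sh}}$, $\mathrm{Sh}(s)=\{k\in\mathbb{N}: k\le_{\mathrm{Sh}} s\}$. For $a\le b$, $M(a,b)=\{n\in\mathbb{N}: a<k/n<b\text{ for some integer }k\}$. For $\rho\in\mathbb{R}$ and $A\subset\mathbb{N}$, $\Lambda(\rho,A)=\emptyset$ if $\rho\notin\mathbb{Q}$, and $\Lambda(\rho,A)=\{nq:q\in A\}$ if $\rho=k/n$ with $k\in\mathbb{Z}$, $n\in\mathbb{N}$ coprime. *)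

(* Defs.v *)
From HB Require Import structures.
From mathcomp Require Import all_boot all_order all_algebra.
From mathcomp Require Import complex.
From mathcomp Require Import all_classical all_reals all_analysis.

Set Implicit Arguments.
Unset Strict Implicit.
Unset Printing Implicit Defensive.

Import Order.TTheory GRing.Theory Num.Theory.
Import numFieldNormedType.Exports.

Local Open Scope classical_set_scope.
Local Open Scope ring_scope.
Local Open Scope complex_scope.

(* [R[i]] with the topology of the modulus. *)
HB.instance Definition _ (R : rcfType) := NormedModule.copy R[i] R[i]^o.

Section GraphS.
Variable R : realType.

Definition real_axis : set R[i] := [set z | complex.Im z = 0].

Definition branches : set R[i] :=
  [set z | (exists k : int, complex.Re z = k%:~R) /\ 0 <= complex.Im z <= 1].

Definition graphS : set R[i] := real_axis `|` branches.

(* Maps of [graphS] into itself are represented by total functions, whose values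
   outside [graphS] are never used. *)
Definition L1 (F : R[i] -> R[i]) : Prop :=
  [/\ {within graphS, continuous F},
      forall z, graphS z -> graphS (F z)
    & forall z, graphS z -> F (z + 1) = F z + 1].

Definition returns_mod1 (F : R[i] -> R[i]) (z : R[i]) (n : nat) : Prop :=
  (0 < n)%N /\ exists k : int, iter n F z = z + k%:~R.

Definition period_mod1 (F : R[i] -> R[i]) (z : R[i]) (n : nat) : Prop :=
  returns_mod1 F z n /\ forall m, returns_mod1 F z m -> (n <= m)%N.

Definition rotation_number (F : R[i] -> R[i]) (z : R[i]) (rho : R) : Prop :=
  (fun n : nat => (complex.Re (iter n F z) - complex.Re z) / n%:R)
    @ \oo --> rho.

Definition Rot (F : R[i] -> R[i]) : set R :=
  [set rho | exists2 z, graphS z & rotation_number F z rho].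

Definition Rot_R (F : R[i] -> R[i]) : set R :=
  [set rho | exists2 z, real_axis z & rotation_number F z rho].

Definition Per (F : R[i] -> R[i]) : set nat :=
  [set n | exists2 z, graphS z & period_mod1 F z n].

Definition Per_rot (alpha : R) (F : R[i] -> R[i]) : set nat :=
  [set n | exists z, [/\ graphS z, rotation_number F z alpha & period_mod1 F z n]].

Definition M (a b : R) : set nat :=
  [set n | (0 < n)%N /\ exists k : int, a < k%:~R / n%:R < b].

(* Empty when [rho] is irrational, as no [k], [n] exist. *)
Definition Lambda (rho : R) (A : set nat) : set nat :=
  [set m | exists (k : int) (n : nat),
     [/\ (0 < n)%N, coprime `|k|%N n, rho = k%:~R / n%:R
       & exists2 q, A q & m = (n * q)%N]].

(* [A] is homeomorphic to [0,1], with [c] corresponding to the endpoint 0. *)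
Definition segment_from (X : topologicalType) (c : X) (A : set X) : Prop :=
  exists (h : R -> X) (g : X -> R),
    [/\ {within `[0, 1], continuous h}, {within A, continuous g},
        h @` `[0, 1] = A, {in `[0, 1], cancel h g} & h 0 = c].

(* In a Hausdorff space the three segments are closed, so that [X] carries the
   topology obtained by gluing them at [c]. *)
Definition three_star (X : topologicalType) : Prop :=
  hausdorff_space X /\
  exists (c : X) (A : 'I_3 -> set X),
    [/\ forall i, segment_from c (A i),
        \bigcup_i A i = setT
      & forall i j, i != j -> A i `&` A j = [set c]].

End GraphS.

Definition Per_circ (X : Type) (f : X -> X) : set nat :=
  [set n | (0 < n)%N /\ exists x, iter n f x = x /\
     forall i, (1 <= i <= n.-1)%N -> iter i f x <> x].

(* N_Sh: the positive integers together with the symbol 2^oo. *)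
Variant NSh : Type :=
  | ShNat (n : nat) of (0 < n)%N
  | ShTwoInfty.

Definition odd_part (m : nat) : nat := (m %/ 2 ^ logn 2 m)%N.

(* [sh_ltn m n] for m = 2^a * b and n = 2^c * e with b, e odd: powers of 2 are
   increasing and lie below all the other numbers, which are ordered by
   decreasing 2-adic valuation, then by decreasing odd part. *)
Definition sh_ltn (m n : nat) : bool :=
  let: (a, b) := (logn 2 m, odd_part m) in
  let: (c, e) := (logn 2 n, odd_part n) in
  if b == 1%N then (e != 1%N) || (a < c)%N
  else (e != 1%N) && ((c < a)%N || (a == c) && (e < b)%N).

Definition sh_le (s t : NSh) : bool :=
  match s, t with
  | ShNat m _, ShNat n _ => (m == n) || sh_ltn m n
  | ShNat m _, ShTwoInfty => odd_part m == 1%N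
  | ShTwoInfty, ShNat n _ => odd_part n != 1%N
  | ShTwoInfty, ShTwoInfty => true
  end.

Definition Sh (s : NSh) : set nat :=
  [set k | exists k_gt0 : (0 < k)%N, sh_le (ShNat k_gt0) s].

(* Main.v *)
Require Import Defs.
From mathcomp Require Import all_boot all_order all_algebra.
From mathcomp Require Import complex.
From mathcomp Require Import all_classical all_reals all_analysis.
From mathcomp Require Import zify ring lra.

Import Order.TTheory GRing.Theory Num.Theory.
Import numFieldNormedType.Exports.

Local Open Scope classical_set_scope.
Local Open Scope ring_scope.
Local Open Scope complex_scope.

(** Let [d] be positive; the case of a negative [d] follows by reflection in the
    imaginary axis. The map is made of two independent systems that coexist on the
    graph. The star formed by [[-1/8, 1/8]] and the branch above [0] is mapped into
    itself by a copy of [f] placed on its inner half ([half_star]); the outer halves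
    of the arms are repelled from the fixed tips towards it, so that they only add
    the period 1, which is already in [Per_circ f] since a star has the fixed point
    property ([star_fixpoint], [star_periods]). The complement of the translates of
    this star is a circle with a hole. An expanding map [circle_map] of the circle
    governs it, and an orbit that falls into the hole never leaves it: its rotation
    number is 0 and it is not periodic unless it started there ([orbit_cases]).

    Away from the hole the circle map moves every point forward, hence a cycle there
    has a rotation number [k / n] with [0 < k / n <= d]. If [k / n < d], its period
    [n] is in [M 0 d] by definition. Since [M 0 d] consists of the [n] with
    [n^-1 < d], it is enough to find conversely a cycle that makes one turn in [n]
    steps. It remains to realise all the rotation numbers and to control the
    cycles of rotation number [d].

    Both come from a family of explicit series [srs rho], by which the translation
    by [rho] is turned into the linear expanding part of the circle map ([srs_rec]).
    For [0 <= rho <= d] the values of [srs rho] are points of rotation number [rho],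
    periodic if [rho = n^-1]. For [rho = d] a variant of the series is a monotone
    coordinate in which the circle map never advances by more than [d]
    ([circle_map_upper]). When [d = p / q], a cycle of rotation number [d] must use
    this bound fully, which forces it to meet a small interval, the core, at the end
    of the linear lap ([top_cycle_core]). The first return to the core after [q] steps
    is an arbitrary interval map [g] ([core_return]), so that the periods of these
    cycles are the products of [q] and of a period of [g].

    Finally [g] is chosen with [Sh s_d] as its set of periods ([realisable_Sh]): for
    an odd number the linear map of a Stefan cycle has the right odd periods, which
    can be read off from the only way in which its orbits change the alternation of
    signs ([stefan_period], [stefan_odd]); a doubling operator gives the
    even numbers; and gluing countably many interval maps side by side gives unions,
    in particular the powers of 2. *)

(** * Sets of return times *)

(** Satisfied by the return times of a point, be it to itself or modulo a group of
    translations commuting with the map. *)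
Definition return_monoid (A : nat -> Prop) : Prop :=
  [/\ A 0%N, forall m n, A m -> A n -> A (m + n)%N
    & forall m n, A m -> A (m + n)%N -> A n].

(** Divisibility rather than minimality: conjugacies and changes of base point,
    which preserve all the return times, then preserve periods at once. *)
Definition is_period (A : nat -> Prop) (n : nat) : Prop :=
  (0 < n)%N /\ forall m, A m <-> (n %| m)%N.

(** Euclidean division: the remainder of a return time by the least positive
    one is again a return time. *)
Lemma least_is_period (A : nat -> Prop) (n : nat) : return_monoid A ->
  is_period A n <->
  [/\ (0 < n)%N, A n & forall m, (0 < m)%N -> A m -> (n <= m)%N].
Proof.
case=> A0 AD AB; split=> [[n0 An]|[n0 An nmin]].
  split=> //; first by apply/An.
  by move=> m m0 /An /dvdn_leq; apply.
have AM k : A (k * n)%N.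
  by elim: k => [|k IH] //; rewrite mulSn; apply: AD.
split=> // m; split=> [Am|/dvdnP[k ->]]; last exact: AM.
rewrite /dvdn; apply: contrapT => /negP; rewrite -lt0n => r0.
have /(nmin _ r0) : A (m %% n)%N.
  by apply: (AB (m %/ n * n)%N) => //; rewrite -divn_eq.
by rewrite leqNgt ltn_mod n0.
Qed.

Lemma is_period_ext (A B : nat -> Prop) (n : nat) :
  (forall m, A m <-> B m) -> is_period A n -> is_period B n.
Proof. by move=> AB [n0 An]; split=> // m; rewrite -AB. Qed.

Lemma is_period_mul (A B : nat -> Prop) (q n : nat) : (0 < q)%N ->
  (forall m, A m <-> exists2 j, m = (q * j)%N & B j) ->
  is_period A n <-> exists2 j, n = (q * j)%N & is_period B j.
Proof.
move=> q0 AB; split=> [[n0 An]|[j -> [j0 Bj]]].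
  have [j nE _] := (AB n).1 ((An n).2 (dvdnn n)); exists j => //; split; first by lia.
  move=> m; rewrite -(dvdn_pmul2l q0) -nE -An AB.
  split=> [Bm|[i /eqP + Bi]]; first by exists m.
  by rewrite eqn_pmul2l// => /eqP ->.
split=> [|m]; first by rewrite muln_gt0 q0.
rewrite AB; split=> [[i -> /Bj]|/dvdnP[i ->]]; first by rewrite dvdn_pmul2l.
by exists (i * j)%N; [lia|apply/Bj; exact: dvdn_mull].
Qed.

Definition fix_times {X : Type} (f : X -> X) (x : X) (m : nat) : Prop :=
  iter m f x = x.

Lemma fix_times_monoid {X : Type} (f : X -> X) x : return_monoid (fix_times f x).
Proof.
rewrite /fix_times; split=> // m n => [fm fn|fm]; first by rewrite iterD fn fm.
by rewrite addnC iterD fm.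
Qed.

Lemma Per_circP {X : Type} (f : X -> X) n :
  Per_circ f n <-> exists x, is_period (fix_times f x) n.
Proof.
split=> [[n0 [x [fn nmin]]]|[x]].
  exists x; apply/(least_is_period _ _ (fix_times_monoid f x)); split=> // m m0 fm.
  by rewrite leqNgt; apply/negP => mn; apply: (nmin m) => //; apply/andP; split=> //; lia.
move=> /(least_is_period _ _ (fix_times_monoid f x))[n0 fn nmin].
split=> //; exists x; split=> // i /andP[i0 ilt] /(nmin _ i0).
by lia.
Qed.

Lemma Per_circ1 {X : Type} (f : X -> X) x : f x = x -> Per_circ f 1.
Proof. by move=> fx; split=> //; exists x; split=> // i; case: i. Qed.

Lemma fix_iter {X : Type} (f : X -> X) x m : f x = x -> iter m f x = x.
Proof. by move=> fx; elim: m => //= m ->. Qed.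

Lemma fix_times_fixed {X : Type} (f : X -> X) x n :
  f x = x -> is_period (fix_times f x) n -> n = 1%N.
Proof. by move=> fx [_ /(_ 1%N)[/(_ fx)]]; rewrite dvdn1 => /eqP. Qed.

(** A return of the [i]-th iterate becomes a return of [x] itself by going on to the
    end of the [i]-th turn. *)
Lemma fix_times_iter {X : Type} (f : X -> X) x n i :
  (0 < n)%N -> iter n f x = x ->
  forall m, fix_times f (iter i f x) m <-> fix_times f x m.
Proof.
rewrite /fix_times => n0 fn m; rewrite -iterD addnC iterD.
split=> [|->] // /(congr1 (iter (i * n - i) f)); rewrite -!(iterD (i * n - i) i).
have fk k : iter (k * n) f x = x by elim: k => // k IH; rewrite mulSn iterD IH.
have iE : (i * n - i + i = i * n)%N by apply: subnK; exact: leq_pmulr.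
by rewrite iE fk -iterD addnC iterD fk.
Qed.

(** A function that never increases along orbits is constant on cycles; this is
    how unwanted periodic points are excluded below. *)
Lemma lyapunov_cycle {R : realType} {X : Type} (f : X -> X) (V : X -> R) x n :
  (forall z, V (f z) <= V z) -> (0 < n)%N -> iter n f x = x -> V (f x) = V x.
Proof.
move=> Vf n0 fn; apply/eqP; rewrite eq_le Vf/= -[in leLHS]fn.
have Vi i : V (iter i.+1 f x) <= V (f x).
  by elim: i => // i IH; apply: le_trans IH; exact: Vf.
by rewrite -(prednK n0).
Qed.

(** * Continuous real functions *)

Section RealContinuity.
Context {R : realType} {T : topologicalType}.
Implicit Types f g : T -> R.

Lemma contC (c : R) : continuous (fun _ : T => c).
Proof. by move=> x; exact: cvg_cst. Qed.

Lemma contD f g : continuous f -> continuous g -> continuous (fun x => f x + g x).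
Proof. by move=> cf cg x; apply: cvgD; [exact: cf|exact: cg]. Qed.

Lemma contN f : continuous f -> continuous (fun x => - f x).
Proof. by move=> cf x; apply: cvgN; exact: cf. Qed.

Lemma contM f g : continuous f -> continuous g -> continuous (fun x => f x * g x).
Proof. by move=> cf cg x; apply: cvgM; [exact: cf|exact: cg]. Qed.

Lemma contI : continuous (fun x : T => x).
Proof. by move=> x; exact: cvg_id. Qed.

Lemma cont_min f g : continuous f -> continuous g ->
  continuous (fun x => Num.min (f x) (g x)).
Proof. by move=> cf cg x; apply: continuous_min; [exact: cf|exact: cg]. Qed.

Lemma cont_max f g : continuous f -> continuous g ->
  continuous (fun x => Num.max (f x) (g x)).
Proof. by move=> cf cg x; apply: continuous_max; [exact: cf|exact: cg]. Qed.

End RealContinuity.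

Lemma cont_comp {S T U : topologicalType} (f : S -> T) (g : T -> U) :
  continuous g -> continuous f -> continuous (fun x => g (f x)).
Proof. by move=> cg cf x; apply: (@continuous_comp _ _ _ f g); [exact: cf|exact: cg]. Qed.

Definition clamp {R : realType} (a b x : R) : R := Num.max a (Num.min b x).

Variant clamp_spec {R : realType} (a b x : R) : R -> Prop :=
  | ClampLo of x <= a : clamp_spec a b x a
  | ClampIn of a <= x & x <= b : clamp_spec a b x x
  | ClampHi of b <= x : clamp_spec a b x b.

Lemma clampP {R : realType} (a b x : R) : a <= b -> clamp_spec a b x (clamp a b x).
Proof.
rewrite /clamp => ab; case: (leP b x) => bx.
  by rewrite (max_idPr ab); constructor.
by case: (leP a x) => ax; constructor=> //; exact: ltW.
Qed.

Lemma clamp_id {R : realType} (a b x : R) : a <= x -> x <= b -> clamp a b x = x.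
Proof. by move=> ax xb; case: (@clampP _ a b x); lra. Qed.

Lemma clamp_lo {R : realType} (a b x : R) : a <= b -> x <= a -> clamp a b x = a.
Proof. by move=> ab xa; case: (@clampP _ a b x); lra. Qed.

Lemma clamp_hi {R : realType} (a b x : R) : a <= b -> b <= x -> clamp a b x = b.
Proof. by move=> ab xa; case: (@clampP _ a b x); lra. Qed.

Lemma cont_clamp {R : realType} {T : topologicalType} (a b : R) (f : T -> R) :
  continuous f -> continuous (fun x => clamp a b (f x)).
Proof. by move=> cf; apply: cont_max; [exact: contC|apply: cont_min => //; exact: contC]. Qed.

Ltac cont := lazymatch goal with
  | |- continuous (fun x => x) => exact contI
  | |- continuous (fun x => - @?f x) => apply (contN f); cont
  | |- continuous (fun x => @?f x + @?g x) => apply (contD f g); cont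
  | |- continuous (fun x => @?f x * @?g x) => apply (contM f g); cont
  | |- continuous (fun x => clamp ?a ?b (@?f x)) => apply (cont_clamp a b f); cont
  | |- continuous (fun x => Num.min (@?f x) (@?g x)) => apply (cont_min f g); cont
  | |- continuous (fun x => Num.max (@?f x) (@?g x)) => apply (cont_max f g); cont
  | H : continuous ?h |- continuous (fun x => ?h (@?f x)) => apply (cont_comp f h H); cont
  | |- continuous _ => first [exact: contC | idtac]
  end.

(** Near a point, only the two unit intervals that end at the nearest integer
    matter, and they are closed. *)
Lemma cont_floor_glue {R : realType} (psi : int -> R -> R) :
  (forall k, continuous (psi k)) ->
  (forall k : int, psi k (k + 1)%:~R = psi (k + 1) (k + 1)%:~R) ->
  continuous (fun x : R => psi (Num.floor x) x).
Proof.
move=> cpsi glue x.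
set F := fun x : R => psi (Num.floor x) x.
(* [k] is the nearest integer, so that [x] is interior to [[k - 1, k + 1]] *)
pose k := Num.floor (x + 2^-1).
have kx : k%:~R <= x + 2^-1 by exact: floor_le.
have xk : x + 2^-1 < (k + 1)%:~R by exact: floorD1_gt.
have seg (j : int) : {within `[j%:~R, (j + 1)%:~R], continuous F}.
  have FE y : j%:~R <= y -> y <= (j + 1)%:~R -> psi j y = F y.
    move=> jy; rewrite /F le_eqVlt => /orP[/eqP->|yj]; first by rewrite intrKfloor glue.
    by rewrite (@floor_def _ _ j)// jy.
  apply: (@subspace_eq_continuous _ _ _ (psi j)); last exact: continuous_subspaceT.
  by move=> y; rewrite inE/= in_itv/= => /andP[]; exact: FE.
have both : {within `[(k - 1)%:~R, (k - 1 + 1)%:~R] `|` `[k%:~R, (k + 1)%:~R], continuous F}.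
  by apply: withinU_continuous; [exact: interval_closed|exact: interval_closed|exact: seg|exact: seg].
have sub : [set` `](k - 1)%:~R, (k + 1)%:~R[%R] `<=`
           `[(k - 1)%:~R, (k - 1 + 1)%:~R] `|` `[k%:~R, (k + 1)%:~R : R].
  move=> y /=; rewrite !in_itv/= subrK => /andP[y1 y2].
  by case: (leP y k%:~R) => ky; [left|right]; rewrite ?ky ltW//= ltW.
have := continuous_subspaceW sub both.
rewrite continuous_open_subspace; last exact: interval_open.
apply; rewrite inE/= in_itv/=; move: kx xk; rewrite !intrD; lra.
Qed.

(** * Interval maps and their sets of periods *)

(** Maps are taken on the whole line and are the identity off an interval, so
    that [Per_circ] applies to them and they can be glued side by side. *)
Definition interval_map {R : realType} (A B : R) (g : R -> R) : Prop :=
  [/\ A < B, continuous g, forall x, A <= x -> x <= B -> A <= g x <= B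
    & forall x, (x <= A) || (B <= x) -> g x = x].

Definition realisable (R : realType) (P : set nat) : Prop :=
  exists (A B : R) (g : R -> R), interval_map A B g /\ Per_circ g = P.

Lemma iter_conj {X Y : Type} (f : X -> X) (g : Y -> Y) (u : X -> Y) x :
  (forall z, u (f z) = g (u z)) -> forall m, u (iter m f x) = iter m g (u x).
Proof. by move=> uf; elim=> //= m <-. Qed.

Lemma Per_circ_conj {X Y : Type} (f : X -> X) (g : Y -> Y) (u : X -> Y) (v : Y -> X) :
  cancel u v -> cancel v u -> (forall x, u (f x) = g (u x)) -> Per_circ f = Per_circ g.
Proof.
move=> uK vK uf; apply/seteqP; split=> n /Per_circP[x px]; apply/Per_circP.
  exists (u x); apply: is_period_ext px => m; rewrite /fix_times -(iter_conj _ _ _ _ uf).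
  by split=> [->|/(can_inj uK)].
have fv m : iter m f (v x) = v (iter m g x).
  by rewrite -[RHS](congr1 v (congr1 (iter m g) (vK x))) -(iter_conj _ _ _ _ uf) uK.
exists (v x); apply: is_period_ext px => m; rewrite /fix_times fv.
by split=> [->|/(can_inj vK)].
Qed.

Lemma realisable_on {R : realType} (P : set nat) (A B : R) : A < B ->
  realisable R P -> exists2 g, interval_map A B g & Per_circ g = P.
Proof.
move=> AB [C [D [g [[CD cg gCD gid] <-]]]].
pose s := (B - A) / (D - C).
have s0 : 0 < s by apply: divr_gt0; lra.
have sE : s * (D - C) = B - A by rewrite /s divfK//; lra.
have sV y : s * (s^-1 * y) = y by rewrite mulrA mulfV ?mul1r//; lra.
pose u x := A + s * (x - C); pose v y := C + s^-1 * (y - A).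
have uK : cancel u v by move=> x; rewrite /u /v [A + _]addrC addrK mulKf ?gt_eqF//; ring.
have vK : cancel v u by move=> x; rewrite /u /v [C + _]addrC addrK sV; lra.
have uw x y : (u x <= u y) = (x <= y) by rewrite /u lerD2l ler_pM2l// lerD2r.
have uC : u C = A by rewrite /u; lra.
have uD : u D = B by rewrite /u sE; lra.
exists (fun y => u (g (v y))); last first.
  by apply/esym; apply: (Per_circ_conj _ _ u v) => // x; rewrite uK.
split=> //.
- by rewrite /u /v; cont.
- move=> y; rewrite -{1}(vK y) -{2}(vK y) -{1}uC -{1}uD !uw => Cv vD.
  by rewrite -uC -uD !uw; exact: gCD.
by move=> y; rewrite -{1}(vK y) -{2}(vK y) -{1}uC -{1}uD !uw => /gid ->; rewrite vK.
Qed.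

(** Outside [[a, b]] the map is prolonged by segments joining the graph to the
    diagonal; the distance to [[a, b]] does not increase along orbits, so the
    only new periodic points are fixed. *)
Lemma realisable_extend {R : realType} (h : R -> R) (a b : R) :
  a < b -> continuous h -> (forall x, a <= h x <= b) ->
  realisable R ([set 1%N] `|` Per_circ h).
Proof.
move=> ab ch hab.
pose g y := h (clamp a b y) + (y - clamp a b y)
  - (h a - a) * clamp 0 1 (a - y) + (b - h b) * clamp 0 1 (y - b).
have g_in y : a <= y -> y <= b -> g y = h y.
  move=> ay yb; rewrite /g clamp_id// (clamp_lo 0 1 (a - y))//; last by lra.
  by rewrite (clamp_lo 0 1 (y - b))//; [ring|lra].
have g_lo y : y <= a -> g y = y + (h a - a) * (1 - clamp 0 1 (a - y)).
  move=> ya; rewrite /g (clamp_lo a b)//; last by lra.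
  by rewrite (clamp_lo 0 1 (y - b))//; [ring|lra].
have g_hi y : b <= y -> g y = y - (b - h b) * (1 - clamp 0 1 (y - b)).
  move=> yb; rewrite /g (clamp_hi a b)//; last by lra.
  by rewrite (clamp_lo 0 1 (a - y))//; [ring|lra].
have lo y : y <= a -> y <= g y <= Num.max y b.
  move=> ya; rewrite g_lo// max_r; last by lra.
  have := hab a; case: clampP => // ? ?; nra.
have hi y : b <= y -> Num.min y a <= g y <= y.
  move=> yb; rewrite g_hi// min_r; last by lra.
  have := hab b; case: clampP => // ? ?; nra.
have gint : interval_map (a - 1) (b + 1) g.
  split; [lra| | |].
  - by rewrite /g; cont.
  - move=> x x1 x2; case: (leP x a) => xa.
      have := lo x xa; rewrite max_r; lra.
    case: (leP b x) => xb; first by have := hi x xb; rewrite min_r; lra.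
    by rewrite g_in; [have := hab x; lra|lra|lra].
  - move=> x /orP[x1|x1].
      rewrite g_lo; last by lra.
      by rewrite (clamp_hi 0 1 (a - x)); [ring|lra|lra].
    rewrite g_hi; last by lra.
    by rewrite (clamp_hi 0 1 (x - b)); [ring|lra|lra].
pose V y := `|y - clamp a b y|.
have V0 y : a <= y -> y <= b -> V y = 0.
  by move=> ay yb; rewrite /V clamp_id// subrr normr0.
have Vlo y : y <= a -> V y = a - y.
  by move=> ya; rewrite /V clamp_lo//; [rewrite ler0_norm; lra|lra].
have Vhi y : b <= y -> V y = y - b.
  by move=> yb; rewrite /V clamp_hi//; [rewrite ger0_norm; lra|lra].
have Vg y : V (g y) <= V y /\ (V (g y) = V y -> a <= y <= b \/ g y = y).
  case: (leP a y) => ay; last first.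
    have := lo y (ltW ay); rewrite max_r; last by lra.
    rewrite (Vlo y (ltW ay)) => /andP[y1 y2].
    by case: (leP (g y) a) => ga; [rewrite (Vlo _ ga)|rewrite (V0 _ (ltW ga) y2)]; split=> [|?]; [lra|right; lra|lra|right; lra].
  case: (leP y b) => yb; last first.
    have := hi y (ltW yb); rewrite min_r; last by lra.
    rewrite (Vhi y (ltW yb)) => /andP[y1 y2].
    by case: (leP b (g y)) => ga; [rewrite (Vhi _ ga)|rewrite (V0 _ y1 (ltW ga))]; split=> [|?]; [lra|right; lra|lra|right; lra].
  rewrite g_in// V0//; last 2 first.
  - by have /andP[] := hab y.
  - by have /andP[] := hab y.
  by rewrite V0//; split=> // _; left; apply/andP.
have iter_in y m : a <= y -> y <= b -> iter m g y = iter m h y /\ a <= iter m h y <= b.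
  move=> ay yb; elim: m => [|m [IH /andP[h1 h2]]]; first by split=> //; apply/andP.
  by rewrite !iterS IH g_in//; split=> //; exact: hab.
exists (a - 1), (b + 1), g; split=> //; apply/seteqP; split=> n.
  move=> /Per_circP[y py]; have [n0 /(_ n)[_ /(_ (dvdnn n)) gn]] := py.
  have Vy : V (g y) = V y by apply: lyapunov_cycle n0 gn => z; case: (Vg z).
  have [/andP[ay yb]|gy] := (Vg y).2 Vy.
    right; apply/Per_circP; exists y; apply: is_period_ext py => m.
    by rewrite /fix_times (iter_in y m ay yb).1.
  by left; rewrite (fix_times_fixed _ _ _ gy py).
case=> [->|/Per_circP[y py]].
  by apply: (@Per_circ1 _ _ (a - 1)); case: gint => _ _ _; apply; rewrite lexx.
have [n0 /(_ n)[_ /(_ (dvdnn n)) hn]] := py.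
have /andP[ay yb] : a <= y <= b by rewrite -hn -(prednK n0); exact: hab.
apply/Per_circP; exists y; apply: is_period_ext py => m.
by rewrite /fix_times (iter_in y m ay yb).1.
Qed.

Lemma interval_mapA {R : realType} (A B : R) g : interval_map A B g -> g A = A.
Proof. by case=> _ _ _; apply; rewrite lexx. Qed.

Lemma interval_mapB {R : realType} (A B : R) g : interval_map A B g -> g B = B.
Proof. by case=> _ _ _; apply; rewrite lexx orbT. Qed.

Lemma interval_map_iter {R : realType} (A B : R) g x m :
  interval_map A B g -> A <= x <= B -> A <= iter m g x <= B.
Proof. by case=> _ _ gAB _ xAB; elim: m => //= m /andP[]; exact: gAB. Qed.

Lemma interval_map_periods {R : realType} (A B : R) g n : interval_map A B g ->
  Per_circ g n <-> exists2 x, A <= x <= B & is_period (fix_times g x) n.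
Proof.
move=> gAB; split=> [/Per_circP[x px]|[x _ px]]; last by apply/Per_circP; exists x.
have [AB _ _ gid] := gAB.
have [xAB|xAB] := boolP (A <= x <= B); first by exists x.
have gx : g x = x by apply: gid; move: xAB; case: (leP A x) => // ?; case: (leP x B); lra.
exists A; first by rewrite lexx ltW.
rewrite (fix_times_fixed _ _ _ gx px); split=> // m.
by rewrite dvd1n /fix_times; split=> // _; apply: fix_iter; exact: interval_mapA gAB.
Qed.

Lemma realisable1 {R : realType} : realisable R [set 1%N].
Proof.
exists 0, 1, id; split.
  by split=> //; [exact: contI|move=> x x0 x1; apply/andP].
apply/seteqP; split=> n => [/Per_circP[x px]|->]; last exact: (@Per_circ1 _ _ 0).
exact: fix_times_fixed px.
Qed.

(** The second iterate of the map [h] of the proof is [g] on [[0, 1]], and [[0, 1]] and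
    [[2, 3]] are exchanged; every point between them but a fixed point is expelled
    towards them. *)
Lemma realisable_double {R : realType} (P : set nat) : realisable R P ->
  realisable R ([set 1%N] `|` [set (2 * k)%N | k in P]).
Proof.
move=> /(realisable_on _ 0 1 ltr01)[g gint <-].
have [_ cg g01 _] := gint.
pose h (x : R) := 2 + g (clamp 0 1 x) - 3 * (clamp 1 2 x - 1) + (clamp 2 3 x - 2).
have ch : continuous h by rewrite /h; cont.
have h1 (x : R) : 0 <= x -> x <= 1 -> h x = 2 + g x.
  move=> x0 x1; rewrite /h clamp_id// (clamp_lo 1 2)//; last by lra.
  by rewrite (clamp_lo 2 3)//; [ring|lra|lra].
have h2 (x : R) : 1 <= x -> x <= 2 -> h x = 6 - 3 * x.
  move=> x0 x1; rewrite /h (clamp_hi 0 1)// (interval_mapB _ _ _ gint) clamp_id//.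
  by rewrite (clamp_lo 2 3)//; [ring|lra].
have h3 (x : R) : 2 <= x -> x <= 3 -> h x = x - 2.
  move=> x0 x1; rewrite /h (clamp_hi 0 1) ?(interval_mapB _ _ _ gint); [|lra|lra].
  by rewrite (clamp_hi 1 2) ?clamp_id//; [ring|lra].
have hcl x : h x = h (clamp 0 3 x).
  rewrite /h; case: (clampP 0 3 x) => // x3.
    by rewrite !(clamp_lo _ _ x) ?(clamp_lo _ _ 0)//; lra.
  by rewrite !(clamp_hi _ _ x) ?(clamp_hi _ _ 3)//; lra.
have hr x : 0 <= h x <= 3.
  rewrite hcl; have : 0 <= clamp 0 3 x <= 3 by case: clampP; lra.
  move: (clamp 0 3 x) => y /andP[y0 y3].
  case: (leP y 1) => y1; first by rewrite h1//; have := g01 y y0 y1; lra.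
  by case: (leP y 2) => y2; [rewrite h2|rewrite h3]; lra.
have heven (x : R) m : 0 <= x <= 1 -> iter (2 * m) h x = iter m g x.
  move=> x01; elim: m => [|m IH]; first by rewrite muln0.
  have /andP[y0 y1] := interval_map_iter _ _ _ _ m gint x01.
  have := g01 _ y0 y1; rewrite mulnS !iterS IH (h1 (iter m g x))// => gm.
  by rewrite h3; [ring|lra|lra].
have hodd (x : R) m : 0 <= x <= 1 -> 2 <= iter (2 * m).+1 h x.
  move=> x01; have /andP[y0 y1] := interval_map_iter _ _ _ _ m gint x01.
  by rewrite iterS heven// h1//; have := g01 _ y0 y1; lra.
have parity (x : R) m : 0 <= x <= 1 ->
    fix_times h x m <-> exists2 j, m = (2 * j)%N & fix_times g x j.
  move=> x01; rewrite /fix_times; split=> [|[j ->]]; last by rewrite heven.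
  rewrite -(odd_double_half m) -mul2n; case: (odd m).
    by rewrite add1n => E; have := hodd x m./2 x01; rewrite E; lra.
  by rewrite add0n heven// => E; exists m./2.
have double (x : R) n : 0 <= x <= 1 -> is_period (fix_times h x) n <->
    exists2 k, n = (2 * k)%N & is_period (fix_times g x) k.
  by move=> x01; apply: is_period_mul => // m; exact: parity.
suff -> : [set 1%N] `|` [set (2 * k)%N | k in Per_circ g] = [set 1%N] `|` Per_circ h.
  by apply: (realisable_extend h 0 3).
apply/seteqP; split=> n.
  case=> [|[k /(interval_map_periods _ _ _ _ gint)[x x01 px] <-]]; first by left.
  by right; apply/Per_circP; exists x; apply/double => //; exists k.
case=> [|/Per_circP[x px]]; first by left.
have [n0 /(_ n)[_ /(_ (dvdnn n)) hn]] := px.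
have /andP[x0 x3] : 0 <= x <= 3 by rewrite -hn -(prednK n0); exact: hr.
have done (y : R) : 0 <= y <= 1 -> is_period (fix_times h y) n ->
    ([set 1%N] `|` [set (2 * k)%N | k in Per_circ g]) n.
  by move=> y01 /(double _ _ y01)[k -> pk]; right; exists k => //; apply/Per_circP; exists y.
have [x1|x1] := leP x 1; first by apply: (done x) => //; apply/andP.
have [x2|x2] := leP 2 x.
  apply: (done (h x)); first by rewrite h3//; lra.
  by apply: is_period_ext px => m; rewrite (fix_times_iter h x n 1).
pose V (y : R) : R := - Num.min `|y - 3/2| (1/2).
have Vout (y : R) : (y <= 1) || (2 <= y) -> V y = - (1/2).
  move=> y12; rewrite /V min_r//; case/orP: y12 => ?.
    by rewrite ler0_norm; lra.
  by rewrite ger0_norm; lra.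
have Vin (y : R) : 1 <= y -> y <= 2 -> V y = - `|y - 3/2|.
  by move=> y1 y2; rewrite /V min_l//; case: (ger0P (y - 3/2)) => ?; lra.
have V12 (y : R) : - (1/2) <= V y.
  by rewrite /V lerN2 ge_min lexx orbT.
have Vmid (y : R) : 1 <= y -> y <= 2 -> V (h y) = - Num.min (3 * `|y - 3/2|) (1/2).
  move=> y1 y2; rewrite /V h2// (_ : 6 - 3 * y - 3/2 = - (3 * (y - 3/2))); last by field.
  by rewrite normrN normrM (ger0_norm (ler0n R 3)).
have Vh (y : R) : V (h y) <= V y.
  have [y1|y1] := leP y 1.
    rewrite [leRHS]Vout ?y1//; rewrite hcl; have := clampP 0 3 y (ltac:(lra)).
    case=> ?; rewrite ?Vout//; try lra.
      by rewrite h1//; have := g01 0 (lexx _) ler01; lra.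
    by rewrite h1//; have := g01 y; lra.
  have [y2|y2] := leP 2 y.
    rewrite [leRHS]Vout ?y2 ?orbT// Vout// hcl.
    by case: (clampP 0 3 y) => *; rewrite ?h3//; lra.
  rewrite (Vmid _ (ltW y1) (ltW y2)) (Vin _ (ltW y1) (ltW y2)) lerN2 le_min.
  have := normr_ge0 (y - 3/2); case: (ger0P (y - 3/2)) => *; lra.
have : V (h x) = V x by apply: lyapunov_cycle n0 hn.
rewrite (Vmid _ (ltW x1) (ltW x2)) (Vin _ (ltW x1) (ltW x2)) => /oppr_inj.
have [c|c] := leP (3 * `|x - 3/2|) (1/2) => E.
  left; apply: (fix_times_fixed _ _ _ _ px); rewrite h2 ?ltW//.
  have /eqP : `|x - 3/2| = 0 by lra.
  by rewrite normr_eq0 => /eqP; lra.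
by move: E; case: (ger0P (x - 3/2)); lra.
Qed.

(** Countably many interval maps are put side by side on [[0, +oo[], which is then
    compactified by [y |-> 1 / (1 + y)]. *)
Lemma realisable_bigcup {R : realType} (P : nat -> set nat) :
  (forall j, realisable R (P j)) -> realisable R (\bigcup_j P j).
Proof.
move=> Preal.
have /choice[g gP] : forall j : nat, exists gj : R -> R,
    interval_map j%:R (j%:R + 1) gj /\ Per_circ gj = P j.
  move=> j; have [|gj gint gper] := realisable_on (P j) j%:R (j%:R + 1) _ (Preal j).
    by rewrite ltrDl ltr01.
  by exists gj.
pose psi (k : int) : R -> R := if k is Posz j then g j else id.
pose G (y : R) := psi (Num.floor y) y.
have psi_lo (k : int) : psi k k%:~R = k%:~R.
  by case: k => // j; exact: interval_mapA (gP j).1.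
have psi_hi (k : int) : psi k (k + 1)%:~R = (k + 1)%:~R.
  by case: k => // j; rewrite intrD; exact: interval_mapB (gP j).1.
have cG : continuous G.
  apply: cont_floor_glue => k; last by rewrite psi_hi psi_lo.
  by case: k => [j|j]; [case: (gP j) => [[]]|exact: contI].
have Gneg y : y < 0 -> G y = y.
  move=> y0; rewrite /G; have : Num.floor y < 0 by rewrite floor_lt_int.
  by case: (Num.floor y).
have Gin (j : nat) y : j%:R <= y -> y <= j%:R + 1 -> G y = g j y.
  move=> jy; rewrite le_eqVlt => /orP[/eqP->|yj].
    have -> : j%:R + 1 = (j%:Z + 1)%:~R :> R by rewrite intrD.
    rewrite /G intrKfloor psi_lo intrD.
    by apply/esym; exact: interval_mapB (gP j).1.
  by rewrite /G (@floor_def _ _ j%:Z)// jy intrD.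
have locate (y : R) : 0 <= y -> exists2 j : nat, j%:R <= y & y <= j%:R + 1.
  move=> y0; exists (Num.trunc y); first by rewrite truncn_le.
  by rewrite natr1 ltW// truncnS_gt.
have Ggt y : -1 < y -> y - 1 <= G y /\ -1 < G y.
  move=> y1; have [y0|y0] := leP 0 y; last by rewrite Gneg//; split; lra.
  have [j jy yj] := locate y y0; rewrite (Gin j)//.
  have [[_ _ gj _] _] := gP j; have /andP[g1 g2] := gj y jy yj.
  have : 0 <= j%:R :> R by exact: ler0n.
  by split; lra.
pose u (y : R) := (1 + y)^-1; pose v (x : R) := x^-1 - 1.
have uK y : -1 < y -> v (u y) = y by rewrite /u /v => y1; rewrite invrK; ring.
have vK x : u (v x) = x by rewrite /u /v addrC subrK invrK.
have v1 x : 0 < x -> -1 < v x by rewrite /v => x0; rewrite ltrBrDr addrC subrr invr_gt0.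
have u0 y : -1 < y -> 0 < u y by rewrite /u => y1; rewrite invr_gt0; lra.
pose f x := if x <= 0 then x else u (G (v x)).
have fpos x : 0 < x -> f x = u (G (v x)) by move=> x0; rewrite /f leNgt x0.
have f0 x : 0 < x -> 0 < f x by move=> x0; rewrite fpos//; apply/u0/(Ggt _ _).2/v1.
have fu y : -1 < y -> f (u y) = u (G y) by move=> y1; rewrite fpos ?uK ?u0.
have iterfu y m : -1 < y -> iter m f (u y) = u (iter m G y) /\ -1 < iter m G y.
  move=> y1; elim: m => // m [IH y2]; rewrite !iterS IH fu//.
  by split=> //; exact: (Ggt _ _).2.
have fnear0 x : x < 1/2 -> `|f x| <= 2 * `|x|.
  move=> xh; have [x0|x0] := leP x 0.
    by rewrite /f x0; have := normr_ge0 x; lra.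
  rewrite !gtr0_norm ?f0// fpos// /u.
  have [Gv _] := Ggt _ (v1 _ x0).
  have vE : (v x + 1) * x = 1 by rewrite /v subrK mulVf// gt_eqF.
  have vx2 : v x > 1 by nra.
  by rewrite -[leLHS]mul1r ler_pdivrMr; [nra|lra].
have cf : continuous f.
  move=> x; have [x0|x0|->] := ltgtP x 0.
  - have : (fun z : R => z) @ x --> f x by rewrite /f ltW//; exact: cvg_id.
    apply: cvg_trans; apply: near_eq_cvg; near=> z.
    by rewrite /f ltW//; near: z; exact: lt_nbhsl.
  - rewrite /continuous_at fpos//; suff : u (G (v z)) @[z --> x] --> u (G (v x)).
      apply: cvg_trans; apply: near_eq_cvg; near=> z.
      by rewrite fpos//; near: z; exact: lt_nbhsr.
    rewrite /u; apply: cvgV; first by have := (Ggt _ (v1 _ x0)).2; lra.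
    apply: cvgD; first exact: cvg_cst.
    apply: (@continuous_comp _ _ _ v G); last exact: cG.
    by rewrite /v; apply: cvgB; [apply: cvgV; [rewrite gt_eqF|exact: cvg_id]|exact: cvg_cst].
  - rewrite /continuous_at {2}/f lexx; apply/cvgrPdist_lt => e e0.
    near=> z; rewrite sub0r normrN; apply: (@le_lt_trans _ _ (2 * `|z|)).
      by apply: fnear0; near: z; apply: lt_nbhsl; lra.
    rewrite -ltr_pdivlMl//; near: z; apply/nbhs_normP; exists (2^-1 * e) => /=.
      by rewrite mulr_gt0.
    by move=> z /=; rewrite sub0r normrN.
have fper1 x : x <= 0 -> forall n, is_period (fix_times f x) n -> n = 1%N.
  by move=> x0 n; apply: fix_times_fixed; rewrite /f x0.
have P1 j : P j 1%N.
  by rewrite -(gP j).2; apply: Per_circ1; exact: interval_mapA (gP j).1.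
have iterGin j m y : j%:R <= y <= j%:R + 1 -> iter m G y = iter m (g j) y.
  move=> y1; elim: m => //= m ->.
  by have /andP[] := interval_map_iter _ _ _ _ m (gP j).1 y1; exact: Gin.
exists 0, 1, f; split.
  split=> //.
  - move=> x; rewrite le_eqVlt => /orP[/eqP <- _|x0 x1]; first by rewrite /f lexx lexx ler01.
    rewrite ltW ?f0// fpos// /u; have : 0 <= v x.
      by rewrite /v subr_ge0 -invr1 lef_pV2// posrE.
    move=> /locate[j jv vj]; rewrite (Gin j)//.
    have [[_ _ gj _] _] := gP j; have /andP[g1 g2] := gj _ jv vj.
    have : 0 <= j%:R :> R by exact: ler0n.
    by move=> j0; rewrite -[leRHS]invr1 lef_pV2 ?posrE//; lra.
  - move=> x /orP[x0|x1]; first by rewrite /f x0.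
    rewrite fpos; last by lra.
    have [vx|vx] := ltP (v x) 0; first by rewrite Gneg.
    have -> : v x = 0.
      apply/eqP; rewrite eq_le vx andbT /v subr_le0 -invr1 lef_pV2// posrE; lra.
    have := psi_lo 0; rewrite /G floor0 => ->.
    have -> : x = 1 by move: vx; rewrite /v subr_ge0 -[leLHS]invr1 lef_pV2 ?posrE//; lra.
    by rewrite /u addr0 invr1.
apply/seteqP; split=> n.
  move=> /Per_circP[x px]; have [x0|x0] := leP x 0.
    by exists 0%N => //; rewrite (fper1 x x0 n px).
  have xE : x = u (v x) by rewrite vK.
  have v0 := v1 x x0.
  have pv : is_period (fix_times G (v x)) n.
    apply: is_period_ext px => m; rewrite /fix_times xE (iterfu _ _ v0).1 uK//.
    by split=> [/(congr1 v)|->//]; rewrite !uK// (iterfu _ _ v0).2.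
  have [vx|vx] := ltP (v x) 0.
    by exists 0%N => //; rewrite (fix_times_fixed _ _ _ (Gneg _ vx) pv).
  have [j jv vj] := locate _ vx; exists j => //.
  rewrite -(gP j).2; apply/Per_circP; exists (v x); apply: is_period_ext pv => m.
  by rewrite /fix_times (iterGin j)// jv.
case=> j _; rewrite -{1}(gP j).2 => /(interval_map_periods _ _ _ _ (gP j).1)[y yj py].
have y1 : -1 < y by have : 0 <= j%:R :> R := ler0n _ _; lra.
apply/Per_circP; exists (u y); apply: is_period_ext py => m.
rewrite /fix_times (iterfu _ _ y1).1 -(iterGin j)//.
by split=> [->//|/(congr1 v)]; rewrite !uK// (iterfu _ _ y1).2.
Unshelve. all: by end_near.
Qed.

Lemma realisableU {R : realType} (P Q : set nat) :
  realisable R P -> realisable R Q -> realisable R (P `|` Q).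
Proof.
move=> rP rQ; have -> : P `|` Q = \bigcup_j (if j is 0%N then P else Q).
  apply/seteqP; split=> [n [Pn|Qn]|n [[|j] _ Pn]]; first by exists 0%N.
  - by exists 1%N.
  - by left.
  - by right.
by apply: realisable_bigcup; case.
Qed.

(** * Stefan maps *)

(** For [n = 2 * k + 1] this is the piecewise linear map joining the points of
    the cycle [0 -> 1 -> -1 -> 2 -> -2 -> ... -> k -> -k -> 0]. *)
Definition stefan {R : realType} (k : nat) (x : R) : R :=
  let y := clamp (- k%:R) k%:R x in
  Num.min (k%:R * (y + k%:R)) (1 - y - clamp 0 1 y).

Section Stefan.
Context {R : realType} (k : nat).
Hypothesis k_gt0 : (0 < k)%N.
Local Notation K := (k%:R : R).
Local Notation h := (@stefan R k).

Lemma stefan_K1 : 1 <= K. Proof. by rewrite ler1n. Qed.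

Lemma stefan_cont : continuous h.
Proof. by rewrite /stefan; cont. Qed.

Lemma stefan_left x : - K <= x -> x <= - (K - 1) -> h x = K * (x + K).
Proof.
have K1 := stefan_K1; move=> x1 x2; rewrite /stefan (clamp_id (- K) K); [|lra|lra].
by rewrite clamp_lo//; [rewrite min_l//; nra|lra].
Qed.

Lemma stefan_neg x : - (K - 1) <= x -> x <= 0 -> h x = 1 - x.
Proof.
have K1 := stefan_K1; move=> x1 x2; rewrite /stefan (clamp_id (- K) K); [|lra|lra].
by rewrite clamp_lo//; rewrite min_r; [ring|nra].
Qed.

Lemma stefan_mid x : 0 <= x -> x <= 1 -> h x = 1 - 2 * x.
Proof.
have K1 := stefan_K1; move=> x1 x2; rewrite /stefan (clamp_id (- K) K); [|lra|lra].
by rewrite clamp_id// min_r; [ring|nra].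
Qed.

Lemma stefan_right x : 1 <= x -> x <= K -> h x = - x.
Proof.
have K1 := stefan_K1; move=> x1 x2; rewrite /stefan (clamp_id (- K) K); [|lra|lra].
by rewrite clamp_hi// min_r; [ring|nra].
Qed.

Lemma stefan_negative x : - K <= x -> x <= 0 -> 0 <= h x <= K.
Proof.
have K1 := stefan_K1; move=> x1 x2; have [x3|x3] := leP x (- (K - 1)).
  by rewrite stefan_left//; nra.
by rewrite stefan_neg//; lra.
Qed.

Lemma stefan_range x : - K <= h x <= K.
Proof.
have K1 := stefan_K1; have -> : h x = h (clamp (- K) K x).
  by rewrite /stefan (clamp_id (- K) K (clamp (- K) K x))//; case: clampP; lra.
have : - K <= clamp (- K) K x <= K by case: clampP; lra.
move: (clamp _ _ _) => y /andP[y1 y2].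
case: (leP y 0) => y3; first by have := stefan_negative y y1 y3; lra.
by case: (leP y 1) => y4; [rewrite stefan_mid|rewrite stefan_right]; lra.
Qed.

(** Once in [[1/2, 1]], a point climbs by one unit every two steps; it is
    only back to [[0, 1/2]] after all of [[1, k]] has been traversed. *)
Lemma stefan_climb v j : 1/2 <= v -> v <= 1 -> (j < k)%N ->
  iter (2 * j).+1 h v = - (2 * v + j%:R - 1).
Proof.
have K1 := stefan_K1; move=> v1 v2; elim: j => [|j IH] jk.
  by rewrite muln0 /= stefan_mid//; lra.
have jK : j%:R + 2 <= K by rewrite -natrD ler_nat; lia.
have j0 : 0 <= j%:R :> R by exact: ler0n.
rewrite mulnS (_ : (2 + 2 * j).+1 = (2 * j).+1.+2)%N// !iterS -iterS IH; last by lia.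
rewrite (stefan_neg (- (2 * v + j%:R - 1))); [|lra|lra].
by rewrite stefan_right -?natr1; lra.
Qed.

Lemma stefan_climb_even v j : 1/2 <= v -> v <= 1 -> (j.+1 < k)%N ->
  iter (2 * j).+2 h v = 2 * v + j%:R.
Proof.
have K1 := stefan_K1; move=> v1 v2 jk; rewrite iterS stefan_climb//; last by lia.
have jK : j%:R + 2 <= K by rewrite -natrD ler_nat; lia.
have j0 : 0 <= j%:R :> R by exact: ler0n.
by rewrite stefan_neg; lra.
Qed.

Lemma stefan_climb_end v : 1/2 <= v -> v <= 1 ->
  iter (2 * k) h v = 2 * K * (1 - v).
Proof.
have K1 := stefan_K1; move=> v1 v2; have kE : (2 * k = (2 * k.-1).+2)%N by lia.
rewrite kE iterS stefan_climb//; last by lia.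
have -> : k.-1%:R = K - 1 by rewrite -[in RHS](prednK k_gt0) -natr1 addrK.
by rewrite stefan_left; [ring|lra|lra].
Qed.

Lemma stefan_climb_neq v m : 1/2 <= v -> v <= 1 -> (0 < m < 2 * k)%N ->
  iter m h v <= 1 - 2 * v \/ 2 * v <= iter m h v.
Proof.
move=> v1 v2 /andP[m0 mk].
have [mo|me] := boolP (odd m).
  have mE : m = (2 * m./2).+1 by rewrite mul2n -[LHS]odd_double_half mo.
  left; rewrite mE stefan_climb//; last by lia.
  have : 0 <= m./2%:R :> R by exact: ler0n.
  by lra.
have mE : m = (2 * m./2.-1).+2.
  have := odd_double_half m; rewrite (negbTE me) add0n -mul2n; lia.
right; rewrite mE stefan_climb_even//; last by lia.
by rewrite lerDl ler0n.
Qed.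

(** The orbit leaves [[0, 1/2]] because the fixed point [1/3] is repelling, with
    multiplier [-2]. *)
Lemma stefan_spiral y m :
  (forall i, (i < m)%N -> 0 <= iter i h y <= 1/2) ->
  iter m h y = 1/3 + (-2) ^+ m * (y - 1/3).
Proof.
have K1 := stefan_K1; elim: m => [|m IH] yin; first by rewrite expr0 /=; ring.
have ym : 0 <= iter m h y <= 1/2 by apply: yin.
rewrite iterS stefan_mid; [|lra|lra].
rewrite IH => [|i im]; last by apply: yin; lia.
by rewrite exprS; field.
Qed.

Lemma pow_neg2 p : 1 <= (-2) ^+ p :> R \/ (-2) ^+ p <= -2 :> R.
Proof.
elim: p => [|p [IH|IH]]; first by left; rewrite expr0.
  by right; rewrite exprS; lra.
by left; rewrite exprS; lra.
Qed.

Lemma pow_neg2S p : (-2) ^+ p.+1 <= -2 :> R \/ 4 <= (-2) ^+ p.+1 :> R.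
Proof. by case: (pow_neg2 p); rewrite exprS; [left|right]; lra. Qed.

(** The cycle goes once through [[1, k]] and spends [p] more steps in [[0, 1/2]]. *)
Lemma stefan_period p : Per_circ h (p + 2 * k)%N.
Proof.
have K1 := stefan_K1; (* A climb from [v] ends at [u = 2 * K * (1 - v)]; then [p] steps of
   [y |-> 1 - 2 * y] lead to [1/3 + s * (u - 1/3)], and [v] is the solution of
   [1/3 + s * (u - 1/3) = v]. *)
pose s : R := (-2) ^+ p.
pose v : R := 1 - (2 + s) / (3 * (1 + 2 * K * s)).
have s12 : 1 <= s \/ s <= -2 by exact: pow_neg2.
have D0 : 1 + 2 * K * s != 0 by case: s12 => ?; apply/eqP; nra.
pose w := (2 + s) / (3 * (1 + 2 * K * s)).
have wE : w * (3 * (1 + 2 * K * s)) = 2 + s by rewrite /w divfK// mulf_neq0.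
have w01 : 0 <= w <= 1/2.
  by case: s12 => ?; apply/andP; split; nra.
have vw : v = 1 - w by [].
have v1 : 1/2 <= v by lra.
have v2 : v <= 1 by lra.
pose u := 2 * K * (1 - v).
have uv : v - 1/3 = s * (u - 1/3).
  by rewrite /u vw; have := wE; nra.
have spiral i : (i <= p)%N -> iter i h u = 1/3 + (-2) ^+ i * (u - 1/3) /\
    ((i < p)%N -> 0 <= iter i h u <= 1/2 /\ iter i h u != v).
  elim/ltn_ind: i => i IH ip.
  have iE : iter i h u = 1/3 + (-2) ^+ i * (u - 1/3).
    by apply: stefan_spiral => l li; case: (IH l li _); [lia|move=> _ []//; lia].
  split=> // ip'; rewrite iE; set e := (-2) ^+ i * _.
  have rE : (-2) ^+ (p - i) * e = v - 1/3.
    by rewrite /e mulrA -exprD subnK.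
  have : (-2) ^+ (p - i) <= -2 :> R \/ 4 <= (-2) ^+ (p - i) :> R.
    have -> : (p - i = (p - i).-1.+1)%N by lia.
    exact: pow_neg2S.
  move: rE; set r : R := (-2) ^+ (p - i) => rE rb.
  have eb : 0 <= 1/3 + e <= 1/2 by case: rb => ?; apply/andP; split; nra.
  by split=> //; apply/eqP => ev; case: rb => ?; nra.
have toend : iter (2 * k) h v = u by exact: stefan_climb_end.
apply/Per_circP; exists v; apply/(least_is_period _ _ (fix_times_monoid h v)).
split; first by lia.
  rewrite /fix_times iterD toend; have [-> _] := spiral p (leqnn p).
  by rewrite -uv addrC subrK.
move=> m m0 mv; rewrite leqNgt; apply/negP => mlt.
have [mk|mk] := leqP (2 * k) m.
  have /= [_] := spiral (m - 2 * k)%N ltac:(lia).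
  move=> /(_ ltac:(lia))[_ /eqP]; apply.
  by rewrite -toend -iterD subnK.
by have := stefan_climb_neq v m v1 v2; rewrite m0 mk mv => /(_ isT)[]; lra.
Qed.

(** The sign alternates along an orbit except when it visits [[0, 1/2]], so a
    cycle of odd period does visit it; unless it is fixed, it then has to leave
    and to climb back through [[1, k]]. *)
Lemma stefan_odd n : odd n -> Per_circ h n -> n = 1%N \/ (2 * k < n)%N.
Proof.
have K1 := stefan_K1; move=> nodd /Per_circP[x px]; have [n0 /(_ n)[_ /(_ (dvdnn n)) hn]] := px.
rewrite /fix_times in hn.
have orb i : - K <= iter i h x <= K.
  case: i => [|i]; last exact: stefan_range.
  by rewrite /= -hn -(prednK n0); exact: stefan_range.
have [i ymid] : exists i, 0 <= iter i h x <= 1/2.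
  apply: contrapT => noi.
  have alt i : (iter i h x < 0) = (x < 0) (+) odd i.
    elim: i => [|i IH]; first by rewrite addbF.
    have nomid l : ~ (0 <= iter l h x <= 1/2) by move=> H; apply: noi; exists l.
    have := orb i; have := nomid i; have := nomid i.+1.
    rewrite [odd i.+1]/= addbN -IH iterS; set y := iter i h x => n1 n2 /andP[y1 y2].
    have [y0|y0] /= := ltP y 0.
      by apply/negbTE; rewrite -leNgt; have := stefan_negative y y1 (ltW y0); lra.
    have yh : 1/2 < y by rewrite ltNge; apply/negP => ?; apply: n2; apply/andP.
    by have [y3|y3] := leP y 1; [rewrite stefan_mid|rewrite stefan_right]; lra.
  by have := alt n; rewrite hn nodd addbT; case: (x < 0).
set y := iter i h x in ymid.
have py : is_period (fix_times h y) n.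
  by apply: is_period_ext px => m; rewrite (fix_times_iter h x n i).
have [yE|y3] := eqVneq y (1/3).
  by left; apply: fix_times_fixed py; rewrite yE stefan_mid; lra.
right; have [_ yn] := py.
have [p pout] : exists p, ~~ (0 <= iter p h y <= 1/2).
  apply: contrapT => noexit.
  have stay i' : 0 <= iter i' h y <= 1/2.
    by apply: contrapT => H; apply: noexit; exists i'; apply/negP.
  have /andP[] := stay n; have /andP[] := stay (n + n)%N.
  have := fun m => stefan_spiral y m (fun i _ => stay i) => S.
  have Sn : iter n h y = y by apply/yn.
  have := S n; rewrite Sn => /eqP E _ _ _ _.
  have {}E : ((-2) ^+ n - 1) * (y - 1/3) = 0 by move/eqP: E; lra.
  move/eqP: E; rewrite mulf_eq0 (subr_eq0 y) (negbTE y3) orbF subr_eq0.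
  case: n n0 {hn px py yn nodd Sn} => // n' _.
  by case: (pow_neg2S n') => ? /eqP; lra.
have [{}p {}pout pmin] := ex_minnP (ex_intro (fun p => ~~ (0 <= iter p h y <= 1/2)) p pout).
have before i' : (i' < p)%N -> 0 <= iter i' h y <= 1/2.
  by move=> ip; apply: contraT => /pmin; rewrite leqNgt ip.
have p0 : (0 < p)%N by case: (p) pout => //; rewrite /= ymid.
set v := iter p h y in pout.
have v01 : 0 <= v <= 1.
  have := before p.-1; rewrite prednK// => /(_ (leqnn _)).
  rewrite /v -[in iter p _ _](prednK p0) iterS => /andP[z1 z2].
  by rewrite stefan_mid; lra.
have v12 : 1/2 < v by rewrite ltNge; apply: contraNN pout => ?; apply/andP; split=> //; lra.
rewrite ltnNge; apply/negP => nk.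
(* [r] is the time from [v] back to [y], less than one period *)
pose r := ((p * n - p) %% n)%N.
have rn : (r < n)%N by rewrite ltn_mod.
have rv : iter r h v = y.
  rewrite /v -iterD; apply/yn; rewrite /r /dvdn modnDml subnK ?modnMl//.
  exact: leq_pmulr.
have [r0|r0] := posnP r; first by move: rv ymid v12; rewrite r0 /= => ->; lra.
have y1 : 1/2 <= v by lra.
have v2 : v <= 1 by lra.
by have := stefan_climb_neq v r y1 v2; rewrite rv r0 (leq_trans rn nk) => /(_ isT)[]; lra.
Qed.

End Stefan.

(** * Every Sharkovsky initial segment is a set of periods *)

Lemma Sh_natE n (n0 : (0 < n)%N) k :
  Sh (ShNat n0) k <-> (0 < k)%N /\ ((k == n) || sh_ltn k n).
Proof. by split=> [[k0 H]|[k0 H]]; [split|exists k0]. Qed.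

Lemma odd_part_double m : (0 < m)%N -> odd_part (2 * m) = odd_part m.
Proof. by move=> m0; rewrite /odd_part lognM// (logn_prime _ (isT : prime 2)) expnS divnMl. Qed.

Lemma logn_double m : (0 < m)%N -> logn 2 (2 * m) = (logn 2 m).+1.
Proof. by move=> m0; rewrite lognM// (logn_prime _ (isT : prime 2)). Qed.

Lemma logn_odd m : odd m -> logn 2 m = 0%N.
Proof. by move=> mo; apply: logn_coprime; rewrite coprime2n. Qed.

Lemma odd_part_odd m : odd m -> odd_part m = m.
Proof. by move=> mo; rewrite /odd_part logn_odd// divn1. Qed.

Lemma sh_ltn_double m n : (0 < m)%N -> (0 < n)%N -> sh_ltn (2 * m) (2 * n) = sh_ltn m n.
Proof. by move=> m0 n0; rewrite /sh_ltn !logn_double// !odd_part_double// !ltnS eqSS. Qed.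

Lemma Sh_double n (n0 : (0 < n)%N) (m0 : (0 < 2 * n)%N) :
  Sh (ShNat m0) = [set 1%N] `|` [set (2 * k)%N | k in Sh (ShNat n0)].
Proof.
apply/seteqP; split=> k.
  move=> /Sh_natE[k0 H]; have [ko|ke] := boolP (odd k).
    left; apply/eqP; move: H; rewrite /sh_ltn logn_odd// odd_part_odd//.
    rewrite logn_double// odd_part_double//.
    case: (k == 1%N) => //=; rewrite andbF orbF => /eqP kE.
    by move: ko; rewrite kE mul2n odd_double.
  have kE : k = (2 * k./2)%N by have := odd_double_half k; rewrite (negbTE ke); lia.
  right; exists k./2 => //; apply/Sh_natE; split; first by lia.
  by move: H; rewrite kE eqn_pmul2l// sh_ltn_double -?kE//; lia.
case=> [->|[j /Sh_natE[j0 H] <-]]; apply/Sh_natE; split=> //; last first.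
- by rewrite eqn_pmul2l// sh_ltn_double.
- by lia.
by rewrite /sh_ltn [logn 2 1]logn1 [odd_part 1]odd_part_odd// logn_double//= orbT orbT.
Qed.

Lemma Sh_odd n (n0 : (0 < n)%N) k : odd n -> (1 < n)%N ->
  Sh (ShNat n0) k <-> (0 < k)%N /\ (odd k -> k = 1%N \/ (n <= k)%N).
Proof.
move=> no n1; rewrite Sh_natE /sh_ltn (logn_odd n no) (odd_part_odd n no).
have nn1 : (n != 1)%N by lia.
rewrite nn1 !ltn0 /=; split=> -[k0 H]; split=> //.
  move=> ko; move: H; rewrite logn_odd// odd_part_odd// ltnn eqxx /=.
  by case: eqVneq => [->|_]; [right|case: eqVneq => [->|_ /ltnW]; [left|right]].
case: ifP => //; first by rewrite orbT.
have [ko|ke] := boolP (odd k).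
  move=> k1; rewrite logn_odd// odd_part_odd// ltnn eqxx /=.
  by case: (H ko) => [kE|]; [move: k1; rewrite odd_part_odd// kE|rewrite leq_eqVlt eq_sym].
have kE : k = (2 * k./2)%N by have := odd_double_half k; rewrite (negbTE ke); lia.
by move=> _; rewrite kE logn_double ?orbT//; lia.
Qed.

(** Doubling passes from [n] to [2 * n], so that it is enough to treat odd [n]. *)
Lemma realisable_ShNat {R : realType} n (n0 : (0 < n)%N) : realisable R (Sh (ShNat n0)).
Proof.
elim/ltn_ind: n n0 => n IH n0; have [no|ne] := boolP (odd n); last first.
  have nE : n = (2 * n./2)%N by have := odd_double_half n; rewrite (negbTE ne); lia.
  have m0 : (0 < n./2)%N by lia.
  move: n0; rewrite nE => n0; rewrite (Sh_double _ m0).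
  by apply: realisable_double; apply: IH; lia.
have [n1|n1] := leqP n 1.
  suff -> : Sh (ShNat n0) = [set 1%N] by exact: realisable1.
  have nE : n = 1%N by lia.
  move: n0; rewrite nE => n0; apply/seteqP; split=> k.
    move=> /Sh_natE[k0]; rewrite /sh_ltn logn1 [odd_part 1]odd_part_odd//= ltn0.
    by rewrite if_same orbF => /eqP.
  by move=> ->; apply/Sh_natE.
have ext j : (0 < j)%N -> realisable R ([set 1%N] `|` Per_circ (@stefan R j)).
  move=> j0; apply: (realisable_extend _ (- j%:R) j%:R); last exact: stefan_range.
    by have : 0 < j%:R :> R; [rewrite ltr0n|lra].
  exact: stefan_cont.
(* the even periods come from the doubling of a map having all periods *)
have k0 : (0 < n./2)%N by lia.
have nE : n = (2 * n./2).+1 by have := odd_double_half n; rewrite no; lia.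
suff -> : Sh (ShNat n0) = ([set 1%N] `|` Per_circ (@stefan R n./2)) `|`
    ([set 1%N] `|` [set (2 * j)%N | j in [set 1%N] `|` Per_circ (@stefan R 1)]).
  by apply: realisableU; [exact: ext|apply: realisable_double; exact: ext].
apply/seteqP; split=> k.
  move=> /(Sh_odd _ n0 k no n1)[k1 H]; have [ko|ke] := boolP (odd k).
    left; case: (H ko) => [->|nk]; [by left|right].
    rewrite (_ : k = (k - 2 * n./2) + 2 * n./2)%N; first exact: stefan_period.
    by lia.
  have kE : k = (2 * k./2)%N by have := odd_double_half k; rewrite (negbTE ke); lia.
  right; right; exists k./2 => //.
  have [k2|k2] := leqP k./2 1; [left => /=; lia|right].
  rewrite (_ : k./2 = (k./2 - 2 * 1) + 2 * 1)%N; first exact: stefan_period.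
  by lia.
move=> H; apply/Sh_odd => //; split.
  by move: H => [[->|[]]|[->|[j + <-]]]//; case=> [->|[]]//; lia.
move=> ko; move: H => [[->|kp]|[->|[j _ jE]]]; [by left| |by left|].
  by case: (stefan_odd _ k0 k ko kp) => [->|kn]; [left|right; lia].
by move: ko; rewrite -jE mul2n odd_double.
Qed.

Lemma realisable_Sh {R : realType} (s : NSh) : realisable R (Sh s).
Proof.
case: s => [n n0|]; first exact: realisable_ShNat.
have e0 j : (0 < 2 ^ j)%N by rewrite expn_gt0.
have opX j : odd_part (2 ^ j) = 1%N by rewrite /odd_part pfactorK// divnn e0.
suff -> : Sh ShTwoInfty = \bigcup_j Sh (ShNat (e0 j)).
  by apply: realisable_bigcup => j; exact: realisable_ShNat.
apply/seteqP; split=> k.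
  case=> k0 /= /eqP k1; exists (logn 2 k) => //; apply/Sh_natE; split=> //.
  rewrite -{1}[k](@divnK (2 ^ logn 2 k)%N); last exact: pfactor_dvdnn.
  by rewrite -/(odd_part k) k1 mul1n eqxx.
case=> j _ /Sh_natE[k0 H]; exists k0 => /=; move: H.
case/orP=> [/eqP ->|]; first by rewrite opX.
by rewrite /sh_ltn opX eqxx /=; case: ifP.
Qed.

(** * Return times modulo the integers *)

Section ReturnMod1.
Context {V : nzRingType} (F : V -> V).

Definition mod1_times (z : V) (m : nat) : Prop := exists k : int, iter m F z = z + k%:~R.

Hypothesis F1 : forall z (k : int), F (z + k%:~R) = F z + k%:~R.

Lemma iterDz m z (k : int) : iter m F (z + k%:~R) = iter m F z + k%:~R.
Proof. by elim: m => //= m ->; rewrite F1. Qed.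

Lemma iter_turns m z (k : int) j :
  iter m F z = z + k%:~R -> iter (j * m) F z = z + (k * j%:Z)%:~R.
Proof.
move=> mk; elim: j => [|j IH]; first by rewrite mulr0 addr0.
rewrite mulSn iterD IH iterDz mk -addrA -intrD; congr (_ + _%:~R).
by rewrite -addn1 PoszD; ring.
Qed.

Lemma mod1_monoid z : return_monoid (mod1_times z).
Proof.
split; first by exists 0; rewrite addr0.
  move=> m n [k mk] [l nl]; exists (l + k); rewrite iterD nl iterDz mk.
  by rewrite intrD -!addrA [k%:~R + _]addrC.
move=> m n [k mk] [l]; rewrite addnC iterD mk iterDz => nl.
by exists (l - k); rewrite intrB addrA -nl addrK.
Qed.

Lemma mod1_times_shift z (k : int) m : mod1_times (z + k%:~R) m <-> mod1_times z m.
Proof.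
split=> -[l E]; exists l; last by rewrite iterDz E addrAC.
by move: E; rewrite iterDz addrAC => /addIr.
Qed.

(** As for [fix_times_iter], since turns commute with iteration. *)
Lemma mod1_times_iter z n i (k : int) : (0 < n)%N -> iter n F z = z + k%:~R ->
  forall m, mod1_times (iter i F z) m <-> mod1_times z m.
Proof.
move=> n0 nk m; split=> -[l]; last first.
  by move=> E; exists l; rewrite -iterD addnC iterD E iterDz.
move=> /(congr1 (iter (i * n - i) F)); rewrite iterDz -!(iterD (i * n - i)).
rewrite -iterD -addnA [(m + i)%N]addnC addnA subnK; last exact: leq_pmulr.
rewrite addnC iterD (iter_turns _ _ _ i nk) iterDz addrAC => /addIr E.
by exists l.
Qed.

End ReturnMod1.

(** * Staircase series *)

(** For [theta = 0] this is the left-continuous staircase [ceil s - 1], and for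
    [theta = 1] the right-continuous one. The values in between will leave room, at
    the end of the linear lap of the circle map, for an interval with dynamics of
    its own. *)
Definition stair {R : realType} (theta s : R) : R :=
  if s \is a Num.int then s - 1 + theta else (Num.floor s)%:~R.

Lemma stair_int {R : realType} (theta : R) (k : int) : stair theta k%:~R = k%:~R - 1 + theta.
Proof. by rewrite /stair intr_int. Qed.

Lemma stair_in {R : realType} (theta s : R) (k : int) :
  k%:~R < s -> s < k%:~R + 1 -> stair theta s = k%:~R.
Proof.
move=> ks sk; have fs : Num.floor s = k by apply: floor_def; rewrite ltW//= intrD.
rewrite /stair fs; case: ifPn => //; rewrite intrEfloor fs => /eqP sE.
by move: ks; rewrite sE ltxx.
Qed.

Variant stair_spec {R : realType} (theta s : R) : R -> Prop :=
  | StairInt (k : int) of s = k%:~R : stair_spec theta s (k%:~R - 1 + theta)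
  | StairIn (k : int) of k%:~R < s & s < k%:~R + 1 : stair_spec theta s k%:~R.

Lemma stairP {R : realType} (theta s : R) : stair_spec theta s (stair theta s).
Proof.
have [/intrP[k ->]|si] := boolP (s \is a Num.int).
  by rewrite stair_int; constructor.
have sk : s < (Num.floor s)%:~R + 1 by rewrite -[1]/(1%:~R) -intrD floorD1_gt.
have ks : (Num.floor s)%:~R < s.
  by rewrite lt_neqAle floor_le andbT -intrEfloor.
by rewrite (stair_in _ _ _ ks sk); constructor.
Qed.

Lemma stairD1 {R : realType} (theta s : R) : stair theta (s + 1) = stair theta s + 1.
Proof.
case: (stairP theta s) => [k ->|k ks sk].
  by rewrite -[1 in LHS]/(1%:~R) -intrD stair_int intrD; ring.
by rewrite (stair_in _ _ (k + 1)) intrD//; lra.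
Qed.

Lemma stair_lt {R : realType} (theta theta' s s' : R) : theta <= 1 -> 0 <= theta' ->
  s < s' -> stair theta s <= stair theta' s'.
Proof.
move=> t1 t0; case: stairP => [k ->|k ks sk]; case: stairP => [l ->|l ls sl].
- rewrite ltr_int -lezD1 -(ler_int R) intrD; lra.
- move=> kl; have : (k <= l)%R by rewrite -ltzD1 -(ltr_int R) intrD; lra.
  by rewrite -(ler_int R); lra.
- move=> kl; have : (k + 1 <= l)%R by rewrite lezD1 -(ltr_int R); lra.
  by rewrite -(ler_int R) intrD; lra.
- move=> ss; have : (k <= l)%R by rewrite -ltzD1 -(ltr_int R) intrD; lra.
  by rewrite -(ler_int R).
Qed.

Lemma stair_le {R : realType} (theta theta' s s' : R) : theta <= 1 -> 0 <= theta' ->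
  theta <= theta' -> s <= s' -> stair theta s <= stair theta' s'.
Proof.
move=> t1 t0 tt; rewrite le_eqVlt => /orP[/eqP <-|]; last exact: stair_lt.
by rewrite /stair; case: ifP => // _; lra.
Qed.

Lemma stair_bound {R : realType} (theta s : R) : 0 <= theta -> theta <= 1 ->
  `|stair theta s| <= `|s| + 1.
Proof.
move=> t0 t1; have : s - 1 <= stair theta s <= s.
  by case: stairP => [k ->|k]; lra.
by move=> /andP[]; case: (ger0P s) => ?; case: (ger0P (stair theta s)) => ?; lra.
Qed.

Section StairSeries.
Context {R : realType} (lam : R).
Hypothesis lam2 : 2 < lam.

(** The solution of the functional equation [srs_rec] below, by which the
    translation [t |-> t + rho] becomes the expanding map
    [y |-> lam * y - (lam - 1) * k] over [[k, k + 1]]. So [srs rho] is an explicit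
    semiconjugacy, and its values are points of rotation number [rho]. *)
Definition srs_term (rho theta t : R) (n : nat) : R :=
  lam^-1 ^+ n * stair theta (t + n%:R * rho).

Definition srs (rho theta t : R) : R :=
  (1 - lam^-1) * limn (series (srs_term rho theta t)).

Let lam_gt0 : 0 < lam. Proof. by move: lam2; lra. Qed.
Let laminv : 0 < lam^-1 /\ lam^-1 < 1/2.
Proof.
have l0 := lam_gt0; have l2 := lam2.
split; first by rewrite invr_gt0.
by rewrite mul1r ltf_pV2// posrE.
Qed.

(* [n <= 2 ^ n] bounds the linear growth of the staircase, hence [2 < lam]. *)
Lemma srs_cvg (rho theta t : R) : 0 <= theta <= 1 -> cvgn (series (srs_term rho theta t)).
Proof.
move=> /andP[t0 t1]; have l2 := lam2; have [l0 l1] := laminv.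
pose C := `|t| + 1 + `|rho|.
apply: normed_cvg; apply: (@series_le_cvg _ _ (geometric C (2 * lam^-1))) => [n|n|n|].
- exact: normr_ge0.
- rewrite /geometric /= mulr_ge0 ?exprn_ge0//; last by lra.
  by rewrite /C !addr_ge0.
- rewrite /srs_term /geometric /= normrM ger0_norm ?exprn_ge0//; last by lra.
  rewrite exprMn mulrA mulrC ler_wpM2r ?exprn_ge0//; first by lra.
  apply: (le_trans (stair_bound _ _ t0 t1)).
  have n2 : n%:R <= 2 ^+ n :> R by rewrite -natrX ler_nat ltnW// ltn_expl.
  have n1 : 1 <= 2 ^+ n :> R by rewrite exprn_ege1//; lra.
  apply: (@le_trans _ _ (`|t| + n%:R * `|rho| + 1)).
    by rewrite lerD2r (le_trans (ler_normD _ _))// normrM normr_nat.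
  have := normr_ge0 t; have := normr_ge0 rho; rewrite /C; nra.
- apply: is_cvg_geometric_series; rewrite ger0_norm; lra.
Qed.

Lemma srs_le (rho theta t rho' theta' t' : R) : 0 <= theta <= 1 -> 0 <= theta' <= 1 ->
  (forall n : nat, stair theta (t + n%:R * rho) <= stair theta' (t' + n%:R * rho')) ->
  srs rho theta t <= srs rho' theta' t'.
Proof.
move=> th th' le; have l2 := lam2; have [l0 l1] := laminv; rewrite /srs ler_pM2l; last by lra.
apply: lim_series_le; [exact: srs_cvg|exact: srs_cvg|].
by move=> n; rewrite /srs_term ler_wpM2l// exprn_ge0//; lra.
Qed.

Lemma srs_rec (rho theta t : R) : 0 <= theta <= 1 ->
  srs rho theta (t + rho) = lam * srs rho theta t - (lam - 1) * stair theta t.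
Proof.
move=> th; have l2 := lam2; have [l0 l1] := laminv; rewrite /srs.
have c1 := srs_cvg rho theta t th; have c2 := srs_cvg rho theta (t + rho) th.
set S1 := limn (series (srs_term rho theta t)).
set S2 := limn (series (srs_term rho theta (t + rho))).
have E n : series (srs_term rho theta t) n.+1 =
           stair theta t + lam^-1 * series (srs_term rho theta (t + rho)) n.
  rewrite /series /= big_nat_recl// mulr_sumr /srs_term expr0 mul0r addr0 mul1r.
  congr (_ + _); apply: eq_bigr => i _; rewrite exprS mulrA.
  by congr (_ * stair _ _); rewrite -natr1; ring.
have : S1 = stair theta t + lam^-1 * S2.
  have h1 : [sequence series (srs_term rho theta t) n.+1]_n @ \oo --> S1.
    by rewrite cvg_shiftS.
  have h2 : [sequence series (srs_term rho theta t) n.+1]_n @ \oo --> stair theta t + lam^-1 * S2.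
    rewrite (funext E); apply: cvgD; first exact: cvg_cst.
    by apply: cvgM; [exact: cvg_cst|].
  exact: (cvg_unique _ h1 h2).
by move=> ->; field; lra.
Qed.

Lemma srsD1 (rho theta t : R) : 0 <= theta <= 1 ->
  srs rho theta (t + 1) = srs rho theta t + 1.
Proof.
move=> th; have l2 := lam2; have [l0 l1] := laminv; rewrite /srs.
have E : series (srs_term rho theta (t + 1)) =
         series (srs_term rho theta t) \+ series (geometric 1 lam^-1).
  apply/funext => n; rewrite /series /= -big_split /=; apply: eq_bigr => i _.
  rewrite /srs_term /geometric /= mul1r (_ : t + 1 + _ = t + i%:R * rho + 1); last by ring.
  by rewrite stairD1 mulrDr mulr1.
have lam1 : `|lam^-1| < 1 by rewrite ger0_norm; lra.
have -> : limn (series (srs_term rho theta (t + 1))) =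
          limn (series (srs_term rho theta t)) + (1 - lam^-1)^-1.
  apply/cvg_lim => //; rewrite E; apply: cvgD; first exact: srs_cvg.
  by rewrite -[X in _ --> X]mul1r; exact: cvg_geometric_series.
by field; lra.
Qed.

Lemma srsDz (rho theta t : R) (k : int) : 0 <= theta <= 1 ->
  srs rho theta (t + k%:~R) = srs rho theta t + k%:~R.
Proof.
move=> th; elim/int_rec: k => [|n IH|n IH]; first by rewrite !addr0.
  by rewrite -addn1 PoszD intrD addrA srsD1// IH addrA.
apply: (@addIr _ 1); rewrite -srsD1// -!addrA.
by rewrite -addn1 PoszD opprD intrD subrK IH.
Qed.

Lemma srs0 (theta t : R) : 0 <= theta <= 1 -> srs 0 theta t = stair theta t.
Proof.
move=> th; have l2 := lam2; have := srs_rec 0 theta t th; rewrite addr0 => E.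
have : (lam - 1) * (srs 0 theta t - stair theta t) = 0 by lra.
move/eqP; rewrite mulf_eq0 => /orP[/eqP|/eqP]; lra.
Qed.

Lemma srs_mono (rho theta t t' : R) : 0 <= theta <= 1 -> t <= t' ->
  srs rho theta t <= srs rho theta t'.
Proof.
move=> th tt; have /andP[t0 t1] := th.
by apply: srs_le => // n; apply: stair_le => //; rewrite lerD2r.
Qed.

End StairSeries.

(** * A circle map with rotation interval [[0, d]] *)

(** On the unit interval the map is linear of slope [lam] on the lap [[0, b]], with
    [0] fixed; on the core [[b, b']] it is a contracted copy of an interval map [g], or
    a plateau when [d] is irrational, as [core_scale] vanishes; it then comes down to
    the trap [[3/4, 1]], which is fixed pointwise and is where the star will be put.
    The ends [b] and [b'] are the points [1] in the coordinates [G] and [H], so that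
    the orbit of [1] under the translation by [d] is the highest one. *)
Section CircleMap.
Context {R : realType} (d : R).
Hypothesis d_gt0 : 0 < d.

(* [3] ensures [2 < lam]; otherwise the two constants serve to keep the core within
   [[0, 1/2]]. *)
Definition lam : R := 3 + 4 * (Num.ceil d)%:~R.
Definition theta : R := 1/4.

Local Notation G := (srs lam d 0).
Local Notation H := (srs lam d theta).
Definition lap_end : R := G 1.
Definition core_end : R := H 1.
Definition core_top : R := H (1 + d).
Local Notation b := lap_end.
Local Notation b' := core_end.

Let th0 : 0 <= (0 : R) <= 1. Proof. by rewrite lexx ler01. Qed.
Let th1 : 0 <= theta <= 1. Proof. by rewrite /theta; lra. Qed.

Lemma lam_gt2 : 2 < lam /\ d <= (Num.ceil d)%:~R.
Proof.
have := ceil_ge d; rewrite /lam => cd; split=> //.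
by have := d_gt0; lra.
Qed.

Let lam2 : 2 < lam. Proof. exact: lam_gt2.1. Qed.

Lemma core_topE : core_top = lam * b' - (lam - 1) * theta.
Proof. by rewrite /core_top srs_rec// (stair_int _ 1) subrr add0r. Qed.

Lemma lap_topE : G (1 + d) = lam * b.
Proof. by rewrite srs_rec// (stair_int _ 1) subrr add0r mulr0 subr0. Qed.

Lemma lap_top_ge1 : 1 <= lam * b.
Proof.
rewrite -lap_topE.
apply: (@le_trans _ _ (stair 0 (1 + d))).
  have d0 := d_gt0; case: stairP => k dk.
    have : (1 + 1 <= k)%R by rewrite lezD1 -(ltr_int R); lra.
    by rewrite -(ler_int R) intrD; lra.
  move=> dk'; have : (1 <= k)%R by rewrite -ltzD1 -(ltr_int R) intrD; lra.
  by rewrite -(ler_int R).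
rewrite -(srs0 lam)//; apply: srs_le => // n; apply: stair_le => //.
by rewrite lerD2l mulr0 mulr_ge0// ltW.
Qed.

Lemma G_le_H t : G t <= H t.
Proof. by apply: srs_le => // n; have /andP[? ?] := th1; exact: stair_le. Qed.

Lemma lap_end_lt : b < b'.
Proof.
have := G_le_H (1 + d); rewrite -/core_top core_topE lap_topE /theta.
by have := lam2; nra.
Qed.

Lemma core_end_le : b' <= 1/2.
Proof.
have dc := lam_gt2.2; have l2 := lam2.
have : core_top <= b' + (Num.ceil d)%:~R.
  by rewrite /b' -srsDz// /core_top; apply: srs_mono => //; rewrite lerD2l.
rewrite core_topE /theta /lam; have := d_gt0; nra.
Qed.

Lemma lap_end_gt0 : 0 < b.
Proof. by have := lap_top_ge1; have := lam2; nra. Qed.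

Lemma lap_top_le_top : lam * b <= core_top.
Proof. by rewrite -lap_topE; exact: G_le_H. Qed.

Context (g : R -> R).
Hypothesis gint : interval_map b b' g.

Definition core_scale : R := (core_top - lam * b) / (b' - b).
Definition core_slope : R := (core_top - 3/4) / (3/4 - b').

(* A sum of ramps, constant outside of the pieces; the ends of [g] are fixed. *)
Definition circle_piece (y : R) : R :=
  lam * clamp 0 b y + core_scale * (g (clamp b b' y) - b)
  - core_slope * (clamp b' (3/4) y - b') + Num.max 0 (y - 3/4).

Definition circle_map (y : R) : R := circle_piece (y - (Num.floor y)%:~R) + (Num.floor y)%:~R.
Local Notation Phi := circle_map.

Ltac facts := have := lam2; have := lap_top_ge1; have := lap_end_lt;
  have := core_end_le; have := lap_end_gt0; have := lap_top_le_top.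

Lemma core_scale_ge0 : 0 <= core_scale.
Proof. by rewrite /core_scale; apply: divr_ge0; facts; lra. Qed.

Lemma core_scaleE : core_scale * (b' - b) = core_top - lam * b.
Proof. by rewrite /core_scale divfK//; facts; lra. Qed.

Lemma core_slope_ge0 : 0 <= core_slope.
Proof. by rewrite /core_slope; apply: divr_ge0; facts; lra. Qed.

Lemma core_slopeE : core_slope * (3/4 - b') = core_top - 3/4.
Proof. by rewrite /core_slope divfK//; facts; lra. Qed.

Lemma piece_lap y : 0 <= y -> y <= b -> circle_piece y = lam * y.
Proof.
move=> y0 y1; rewrite /circle_piece clamp_id//; facts => *.
rewrite (clamp_lo b b'); [|lra|lra]; rewrite (interval_mapA _ _ _ gint).
rewrite (clamp_lo b'); [|lra|lra]; rewrite max_l; [ring|lra].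
Qed.

Lemma piece_core y : b <= y -> y <= b' -> circle_piece y = lam * b + core_scale * (g y - b).
Proof.
move=> y0 y1; facts => *; rewrite /circle_piece (clamp_hi 0); [|lra|lra].
rewrite (clamp_id b)// (clamp_lo b'); [|lra|lra]; rewrite max_l; [ring|lra].
Qed.

Lemma piece_descent y : b' <= y -> y <= 3/4 ->
  circle_piece y = core_top - core_slope * (y - b').
Proof.
move=> y0 y1; facts => *; rewrite /circle_piece (clamp_hi 0); [|lra|lra].
rewrite (clamp_hi b); [|lra|lra]; rewrite (interval_mapB _ _ _ gint) core_scaleE.
rewrite clamp_id//; rewrite max_l; [ring|lra].
Qed.

Lemma piece_trap y : 3/4 <= y -> circle_piece y = y.
Proof.
move=> y0; facts => *; rewrite /circle_piece (clamp_hi 0); [|lra|lra].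
rewrite (clamp_hi b); [|lra|lra]; rewrite (interval_mapB _ _ _ gint) core_scaleE.
rewrite (clamp_hi b'); [|lra|lra]; rewrite core_slopeE.
by rewrite max_r; [ring|lra].
Qed.

Lemma circle_mapE (k : int) y : k%:~R <= y -> y <= k%:~R + 1 ->
  Phi y = circle_piece (y - k%:~R) + k%:~R.
Proof.
facts => ? ? ? ? ? ? ky; rewrite le_eqVlt => /orP[/eqP ->|yk].
  have -> : k%:~R + 1 = (k + 1)%:~R :> R by rewrite intrD.
  rewrite /circle_map intrKfloor subrr piece_lap//; last by lra.
  have -> : (k + 1)%:~R - k%:~R = 1 :> R by rewrite intrD; ring.
  by rewrite piece_trap ?intrD; lra.
by rewrite /circle_map (@floor_def _ _ k)// ky intrD.
Qed.

Lemma circle_map_cont : continuous Phi.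
Proof.
facts => ? ? ? ? ? ?; have [_ cg _ _] := gint.
rewrite /circle_map; apply: (cont_floor_glue (fun k y => circle_piece (y - k%:~R) + k%:~R)).
  by move=> k; rewrite /circle_piece; cont.
move=> k; rewrite subrr (piece_lap 0)//; last by lra.
have -> : (k + 1)%:~R - k%:~R = 1 :> R by rewrite intrD; ring.
  by rewrite piece_trap ?intrD; lra.
Qed.

Lemma circle_mapDz y (k : int) : Phi (y + k%:~R) = Phi y + k%:~R.
Proof.
rewrite /circle_map floorDrz ?intr_int// intrKfloor intrD addrA.
by congr (circle_piece _ + _ + _); ring.
Qed.

Lemma circle_map_trap y : 3/4 <= y -> y <= 1 -> Phi y = y.
Proof. by move=> y0 y1; rewrite (circle_mapE 0)//; [rewrite subr0 addr0 piece_trap|lra|lra]. Qed.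

Lemma circle_map_lap (k : int) y : k%:~R <= y -> y <= k%:~R + b ->
  Phi y = lam * y - (lam - 1) * k%:~R.
Proof.
facts => ? ? ? ? ? ? ky yk; rewrite (circle_mapE k); [|lra|lra].
by rewrite piece_lap; [ring|lra|lra].
Qed.

Lemma circle_map_core y : b <= y -> y <= b' -> Phi y = lam * b + core_scale * (g y - b).
Proof.
facts => ? ? ? ? ? ? ky yk; rewrite (circle_mapE 0); [|lra|lra].
by rewrite subr0 addr0 piece_core.
Qed.

Lemma core_bounds y : b <= y -> y <= b' -> 0 <= core_scale * (g y - b) <= core_top - lam * b.
Proof.
case: gint => _ _ gb _ y0 y1; have /andP[g0 g1] := gb y y0 y1.
rewrite -core_scaleE mulr_ge0 ?core_scale_ge0 ?subr_ge0//=.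
by rewrite ler_wpM2l ?core_scale_ge0// lerD2r.
Qed.

Lemma piece_gt y : 0 < y -> y < 3/4 -> y < circle_piece y.
Proof.
facts => ? ? ? ? ? ? y0 y1; case: (leP y b) => yb; first by rewrite piece_lap; nra.
case: (leP y b') => yb'; first by rewrite (piece_core _ (ltW yb) yb'); have := core_bounds y (ltW yb) yb'; lra.
rewrite (piece_descent _ (ltW yb') (ltW y1)).
have := core_slope_ge0; have := core_slopeE; nra.
Qed.

Lemma circle_map_gt y : 0 < y -> y < 3/4 -> y < Phi y.
Proof.
by move=> y0 y1; rewrite (circle_mapE 0); [rewrite subr0 addr0 piece_gt|lra|lra].
Qed.

Lemma piece_le y : 0 <= y -> y <= 1 -> circle_piece y <= core_top.
Proof.
facts => ? ? ? ? ? ? y0 y1; case: (leP y b) => yb; first by rewrite piece_lap; nra.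
case: (leP y b') => yb'; first by rewrite (piece_core _ (ltW yb) yb'); have := core_bounds y (ltW yb) yb'; lra.
case: (leP y (3/4)) => y34; last by rewrite piece_trap; lra.
by rewrite (piece_descent _ (ltW yb') y34); have := core_slope_ge0; nra.
Qed.

Lemma circle_map_le (k : int) y : y <= k%:~R + 1 -> Phi y <= k%:~R + core_top.
Proof.
move=> yk; pose l := Num.floor y.
have ly : l%:~R <= y by exact: floor_le.
have yl : y < l%:~R + 1 by rewrite -[1]/(1%:~R) -intrD; exact: floorD1_gt.
facts => ? ? ? ? ? ?; have [lk|kl] := leP l k.
  rewrite (circle_mapE l)//; last exact: ltW.
  have := piece_le (y - l%:~R); move: lk; rewrite -(ler_int R); lra.
have yE : y = k%:~R + 1.
  by move: kl; rewrite -lezD1 -(ler_int R) intrD; lra.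
rewrite yE (circle_mapE k)//; last by lra.
have -> : k%:~R + 1 - k%:~R = 1 :> R by ring.
by rewrite piece_trap; lra.
Qed.

(** ** Upper bound for the displacement *)

Lemma srs_unit (rho t : R) (k : int) : k%:~R < t -> t <= k%:~R + 1 ->
  0 <= rho -> rho <= d -> k%:~R <= srs lam rho 0 t <= k%:~R + b.
Proof.
move=> kt tk r0 rd; apply/andP; split.
  have -> : k%:~R = stair 0 t :> R.
    move: tk; rewrite le_eqVlt => /orP[/eqP ->|tk]; last by rewrite (stair_in _ _ k).
    by rewrite -[1]/(1%:~R) -intrD stair_int intrD; ring.
  rewrite -(srs0 lam)//; apply: srs_le => // i; apply: stair_le => //.
  by rewrite lerD2l mulr0 mulr_ge0.
rewrite addrC /lap_end -srsDz// addrC; apply: srs_le => // i.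
apply: stair_le => //.
by apply: lerD => //; rewrite ler_wpM2l.
Qed.

Lemma H_below (t : R) (k : int) : t < k%:~R + 1 -> H t <= k%:~R + b.
Proof.
move=> tk; rewrite addrC /lap_end -srsDz//; apply: srs_le => // i.
have /andP[? ?] := th1; apply: stair_lt => //.
by rewrite ltr_leD// addrC.
Qed.

Lemma locate_unit (t : R) : exists2 k : int, k%:~R < t & t <= k%:~R + 1.
Proof.
exists (Num.ceil t - 1); first exact: ceilB1_lt.
by rewrite intrD subrK ceil_ge.
Qed.

(** [H] conjugates the translation by [d] to a nondecreasing map that lies above
    [circle_map]. *)
Lemma circle_map_upper y t : y <= H t -> Phi y <= H (t + d).
Proof.
move=> yt; have [k kt tk] := locate_unit t.
have top_k : k%:~R + core_top = H (k%:~R + 1 + d).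
  by rewrite addrC /core_top -srsDz//; congr (H _); ring.
have [yk|ky] := leP y k%:~R.
  apply: (@le_trans _ _ ((k - 1)%:~R + core_top)); first by apply: circle_map_le; rewrite intrD; lra.
  have -> : (k - 1)%:~R + core_top = H (k%:~R + d).
    by rewrite addrC /core_top -srsDz//; congr (H _); rewrite intrD; ring.
  by apply: srs_mono => //; lra.
move: tk; rewrite le_eqVlt => /orP[/eqP tE|tk].
  rewrite tE -top_k; apply: circle_map_le; apply: (le_trans yt).
  by rewrite tE addrC srsDz// -/core_end; facts; lra.
have yb := le_trans yt (H_below _ _ tk).
rewrite (circle_map_lap k _ (ltW ky) yb) srs_rec// (stair_in _ _ k)//.
by rewrite lerD2r ler_pM2l//; facts; lra.
Qed.

Lemma circle_iter_upper y t n : y <= H t -> iter n Phi y <= H (t + n%:R * d).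
Proof.
move=> yt; elim: n => [|n IH]; first by rewrite mul0r addr0.
by rewrite iterS -natr1 mulrDl mul1r addrA; exact: circle_map_upper.
Qed.

Lemma circle_iter_le y n : iter n Phi y <= y + n%:R * d + 3.
Proof.
have /(circle_iter_upper _ _ n) : y <= H (1 + (Num.ceil y)%:~R).
  by rewrite srsDz// -/core_end; have := ceil_ge y; facts; lra.
move=> /le_trans; apply.
have := srs_mono lam lam2 d theta (1 + (Num.ceil y)%:~R + n%:R * d)
  (1 + (Num.ceil y + Num.ceil (n%:R * d))%:~R) th1.
rewrite -addrA lerD2l intrD lerD2l ceil_ge => /(_ isT).
rewrite -intrD srsDz// intrD -/core_end.
have := ceilB1_lt y; have := ceilB1_lt (n%:R * d); rewrite !intrD; facts; lra.
Qed.

(** ** Orbits of prescribed rotation number *)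

(** For [rho <= d] the values of [srs rho] stay in the linear laps. *)
Lemma circle_srs (rho t : R) : 0 <= rho -> rho <= d ->
  Phi (srs lam rho 0 t) = srs lam rho 0 (t + rho).
Proof.
move=> r0 rd; have [k kt tk] := locate_unit t.
have /andP[] := srs_unit rho t k kt tk r0 rd => s0 s1.
rewrite (circle_map_lap k)// srs_rec//; congr (_ - _ * _).
move: tk; rewrite le_eqVlt => /orP[/eqP ->|tk]; last by rewrite (stair_in _ _ k).
by rewrite -[1]/(1%:~R) -intrD stair_int intrD; ring.
Qed.

Lemma circle_srs_iter (rho t : R) n : 0 <= rho -> rho <= d ->
  iter n Phi (srs lam rho 0 t) = srs lam rho 0 (t + n%:R * rho).
Proof.
move=> r0 rd; elim: n => [|n IH]; first by rewrite mul0r addr0.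
by rewrite iterS IH circle_srs// -addrA -natr1 mulrDl mul1r.
Qed.

(** ** The upper end of the rotation interval, when it is rational *)

Lemma circle_iterDz m y (k : int) : iter m Phi (y + k%:~R) = iter m Phi y + k%:~R.
Proof. by apply: iterDz; exact: circle_mapDz. Qed.

Section RationalEnd.
Context (p : int) (q : nat).
Hypothesis q_gt0 : (0 < q)%N.
Hypothesis pq_coprime : coprime `|p|%N q.
Hypothesis dE : d = p%:~R / q%:R.

Let q0 : 0 < q%:R :> R. Proof. by rewrite ltr0n. Qed.

Lemma turn_qd : q%:R * d = p%:~R.
Proof. by rewrite dE mulrCA divff ?mulr1// gt_eqF. Qed.

Lemma turn_dvd (i : nat) (k : int) : i%:R * d = k%:~R -> (q %| i)%N.
Proof.
move=> E; have : i%:Z * p = k * q%:Z.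
  apply: (@intr_inj R); rewrite !intrM -turn_qd -E; ring.
move=> /(congr1 absz); rewrite !abszM !absz_nat => E'.
by rewrite -(@Gauss_dvdl q i `|p|%N) ?E' ?dvdn_mull// coprime_sym.
Qed.

Lemma turn_nonint i : (0 < i < q)%N ->
  exists k : int, k%:~R < 1 + i%:R * d /\ 1 + i%:R * d < k%:~R + 1.
Proof.
move=> /andP[i0 iq]; have [k k1 k2] := locate_unit (1 + i%:R * d).
exists k; split=> //; rewrite lt_neqAle k2 andbT; apply/eqP => E.
have /turn_dvd/(dvdn_leq i0) : i%:R * d = k%:~R by lra.
by rewrite leqNgt iq.
Qed.


Lemma srs_turn_step i (k : int) (th : R) : 0 <= th <= 1 ->
  k%:~R < 1 + i%:R * d -> 1 + i%:R * d < k%:~R + 1 ->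
  srs lam d th (1 + i.+1%:R * d) = lam * srs lam d th (1 + i%:R * d) - (lam - 1) * k%:~R.
Proof.
move=> thb k1 k2; rewrite -natr1 mulrDl mul1r addrA srs_rec//.
by rewrite (stair_in _ _ k).
Qed.

(** The orbits of [b] and [b'] diverge as fast as the linear laps allow. *)
Lemma core_gap i : (i < q)%N ->
  H (1 + i.+1%:R * d) - G (1 + i.+1%:R * d) = lam ^+ i * (core_top - lam * b).
Proof.
elim: i => [|i IH] iq.
  by rewrite expr0 !mul1r lap_topE.
have [|k [k1 k2]] := turn_nonint i.+1; first by rewrite iq.
rewrite !(srs_turn_step i.+1 k)// exprS -mulrA -IH; last exact: ltnW.
by ring.
Qed.

Lemma core_scale_pow : lam ^+ q.-1 * core_scale = 1.
Proof.
have := core_gap q.-1; rewrite prednK// leqnn => /(_ isT).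
rewrite turn_qd !srsDz// => E.
by rewrite /core_scale mulrA -E opprD addrACA subrr addr0 divff// subr_eq0 gt_eqF//; exact: lap_end_lt.
Qed.

Lemma core_iter x i : b <= x -> x <= b' -> (i < q)%N ->
  iter i.+1 Phi x = G (1 + i.+1%:R * d) + lam ^+ i * (core_scale * (g x - b)) /\
  ((i.+1 < q)%N -> exists k : int, k%:~R <= iter i.+1 Phi x <= k%:~R + b).
Proof.
move=> x0 x1; have cb := core_bounds x x0 x1.
have inlap j : iter j.+1 Phi x = G (1 + j.+1%:R * d) + lam ^+ j * (core_scale * (g x - b)) ->
    (j.+1 < q)%N -> forall k : int, k%:~R < 1 + j.+1%:R * d -> 1 + j.+1%:R * d < k%:~R + 1 ->
    k%:~R <= iter j.+1 Phi x <= k%:~R + b.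
  move=> -> jq k k1 k2.
  have := srs_unit d (1 + j.+1%:R * d) k k1 (ltW k2) (ltW d_gt0) (lexx d).
  have := H_below _ _ k2; have := core_gap j (ltnW jq).
  have : 0 <= lam ^+ j by rewrite exprn_ge0//; have := lam2; lra.
  by move: cb => /andP[c1 c2] l0 E Hb /andP[s1 s2]; apply/andP; split; nra.
elim: i => [|i IH] iq.
  have E : iter 1 Phi x = G (1 + 1%:R * d) + lam ^+ 0 * (core_scale * (g x - b)).
    by rewrite /= circle_map_core// expr0 !mul1r lap_topE.
  split=> // jq; have [|k [k1 k2]] := turn_nonint 1; first by rewrite jq.
  by exists k; exact: inlap.
have [|k [k1 k2]] := turn_nonint i.+1; first by rewrite iq.
have [Ei _] := IH (ltnW iq).
have /andP[w1 w2] := inlap i Ei iq k k1 k2.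
have E : iter i.+2 Phi x = G (1 + i.+2%:R * d) + lam ^+ i.+1 * (core_scale * (g x - b)).
  rewrite iterS (circle_map_lap k)// Ei (srs_turn_step i.+1 k)// exprS; ring.
split=> // jq; have [|l [l1 l2]] := turn_nonint i.+2; first by rewrite jq.
by exists l; exact: inlap.
Qed.

(** The [q - 1] linear laps that follow the core undo the contraction by
    [core_scale] exactly, which leaves [g] as the first return map. *)
Lemma core_return x : b <= x -> x <= b' -> iter q Phi x = g x + p%:~R.
Proof.
move=> x0 x1; have [|+ _] := core_iter x q.-1 x0 x1; first by rewrite prednK.
by rewrite prednK// => ->; rewrite mulrA core_scale_pow turn_qd srsDz// mul1r -/b; ring.
Qed.

Lemma core_iter_return x m : b <= x -> x <= b' ->
  iter (q * m) Phi x = iter m g x + (p * m%:Z)%:~R /\ b <= iter m g x <= b'.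
Proof.
move=> x0 x1; elim: m => [|m [IH gm]].
  by rewrite muln0 mulr0 addr0 /= x0 x1.
rewrite mulnS iterD IH circle_iterDz; case: (gint) => _ _ gb _.
have /andP[g0 g1] := gm; split; last by rewrite iterS; exact: gb.
rewrite core_return// iterS -addrA -intrD; congr (_ + _%:~R).
by rewrite -addn1 PoszD; ring.
Qed.

Lemma core_live x i : b <= x -> x <= b' ->
  exists k : int, k%:~R <= iter i Phi x <= k%:~R + 3/4.
Proof.
move=> x0 x1; facts => ? ? ? ? ? ?.
rewrite (divn_eq i q) addnC iterD mulnC.
have [-> /andP[g0 g1]] := core_iter_return x (i %/ q) x0 x1.
rewrite circle_iterDz; set y := iter _ g x in g0 g1 *.
have riq : (i %% q < q)%N by rewrite ltn_mod.
suff [k kP] : exists k : int, k%:~R <= iter (i %% q) Phi y <= k%:~R + 3/4.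
  by exists (k + p * (i %/ q)%:Z); rewrite intrD; lra.
case: (i %% q)%N riq => [|r] rq; first by exists 0; rewrite /=; lra.
have [|_ /(_ rq)[k kP]] := core_iter y r g0 g1; first exact: ltnW.
by exists k; lra.
Qed.

(** A return after [m] steps also gives one after [q * m] steps, when the point is
    back in the core, which is too short to contain two points that differ by a
    nonzero integer; the number of turns is then the one of the rotation. *)
Lemma core_times x : b <= x -> x <= b' -> forall m,
  mod1_times Phi x m <-> exists2 j, m = (q * j)%N & fix_times g x j.
Proof.
move=> x0 x1 m; split=> [[k mk]|[j -> gj]]; last first.
  by exists (p * j%:Z); have [-> _] := core_iter_return x j x0 x1; rewrite gj.
have := core_iter_return x m x0 x1.
rewrite (iter_turns _ circle_mapDz _ _ _ q mk) => -[E /andP[g0 g1]].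
have kE : k * q%:Z = p * m%:Z.
  apply/eqP; rewrite eq_le -!ltzD1 -!(ltr_int R) !intrD; facts => *; lra.
have qm : (q %| m)%N.
  have := congr1 absz kE; rewrite !abszM !absz_nat => E'.
  by rewrite -(@Gauss_dvdr q `|p|%N m) -?E' ?dvdn_mull// coprime_sym.
have [j mE] := dvdnP qm; exists j; first by rewrite mulnC.
move: mk; rewrite mE mulnC; have [-> _] := core_iter_return x j x0 x1.
have -> : k = p * j%:Z.
  apply: (@mulIf _ q%:Z); first by rewrite -lt0n.
  by rewrite kE mE PoszM; ring.
by move/addIr.
Qed.

Lemma turn_solve (j : int) : exists (i : nat) (l : int), j + i%:Z * p = l * q%:Z.
Proof.
have q0z : q%:Z != 0 by rewrite -lt0n.
have : coprimez p q%:Z by rewrite /coprimez /gcdz /= eqz_nat.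
case/coprimezP => -[u v] /= uv.
exists `|(- (j * u) %% q%:Z)%Z|%N; exists (j * v - (- (j * u) %/ q%:Z)%Z * p).
rewrite gez0_abs ?modz_ge0//.
have E := divz_eq (- (j * u)) q%:Z.
have {E} -> : (- (j * u) %% q%:Z)%Z = - (j * u) - (- (j * u) %/ q%:Z)%Z * q%:Z.
  by rewrite {2}E addrC addKr.
rewrite (_ : j = j * 1) ?mulr1// -{1}[j]mulr1 -{1}uv; ring.
Qed.

(** An orbit that starts below [b], and is still higher than the one of [1 - 1 / q] in
    the coordinate [H], would follow the linear laps together with the orbit of [b],
    and the distance between the two would be multiplied by [lam] each time. *)
Lemma shadow_core x : x <= b' ->
  (forall m : nat, H (1 + m%:R * d - q%:R^-1) < iter m Phi x) -> b <= x.
Proof.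
move=> xb' low; rewrite leNgt; apply/negP => xb.
have l2 := lam2.
have follow m : iter m Phi x = G (1 + m%:R * d) - lam ^+ m * (b - x).
  elim: m => [|m IH]; first by rewrite /= mul0r addr0 expr0 mul1r /b; ring.
  set s := 1 + m%:R * d; have [k ks sk] := locate_unit s.
  have lm : 0 < lam ^+ m by rewrite exprn_gt0//; lra.
  have wb : iter m Phi x <= k%:~R + b.
    have := srs_unit d s k ks sk (ltW d_gt0) (lexx d).
    by rewrite IH -/s => /andP[_]; nra.
  have wk : k%:~R <= iter m Phi x.
    rewrite leNgt; apply/negP => wk.
    have E : (k - 1)%:~R + core_top = H (k%:~R + d).
      by rewrite addrC /core_top -srsDz//; congr (H _); rewrite intrD; ring.
    have := low m.+1; rewrite iterS ltNge => /negP; apply.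
    apply: (@le_trans _ _ (H (k%:~R + d))).
      by rewrite -E; apply: circle_map_le; rewrite intrD; lra.
    apply: srs_mono => //.
    (* [s] is a multiple of [1 / q] *)
    have sq : s * q%:R = (q%:Z + m%:Z * p)%:~R.
      by rewrite intrD intrM -turn_qd /s; ring.
    have : k%:~R * q%:R + 1 <= s * q%:R.
      rewrite sq; have : k * q%:Z + 1 <= q%:Z + m%:Z * p.
        by rewrite lezD1 -(ltr_int R) -sq intrM; rewrite ltr_pM2r.
      by rewrite -(ler_int R) [in leLHS]intrD intrM => kq; exact: kq.
    have qV : q%:R * q%:R^-1 = 1 :> R by rewrite divff// gt_eqF.
    have -> : 1 + m.+1%:R * d = s + d by rewrite /s -natr1; ring.
    move=> ksq.
    have : (k%:~R + q%:R^-1) * q%:R <= s * q%:R by rewrite mulrDl [_^-1 * _]mulrC qV.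
    by rewrite ler_pM2r//; lra.
  rewrite iterS (circle_map_lap k)// IH exprS.
  have -> : 1 + m.+1%:R * d = s + d by rewrite /s -natr1; ring.
  rewrite srs_rec//.
  have -> : stair 0 s = k%:~R; last by ring.
  move: sk; rewrite le_eqVlt => /orP[/eqP ->|sk]; last by rewrite (stair_in _ _ k).
  by rewrite -[1]/(1%:~R) -intrD stair_int intrD; ring.
have bounded m : lam ^+ m * (b - x) <= 1.
  have := low m; rewrite follow.
  have := G_le_H (1 + m%:R * d).
  have : H (1 + m%:R * d - 1) <= H (1 + m%:R * d - q%:R^-1).
    apply: srs_mono => //; rewrite lerD2l lerN2 invf_le1//.
    by rewrite ler1n.
  have -> : 1 + m%:R * d = m%:R * d + 1 by rewrite addrC.
  by rewrite addrK (srsD1 _ lam2 d theta)//; lra.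
have bx : 0 < b - x by lra.
have [m mb] : exists m : nat, (b - x)^-1 < m%:R.
  by exists (Num.trunc (b - x)^-1).+1; rewrite truncnS_gt.
have mlam : m%:R <= lam ^+ m.
  have m2 : m%:R <= 2 ^+ m :> R by rewrite -natrX ler_nat ltnW// ltn_expl.
  by apply: (le_trans m2); rewrite lerXn2r ?nnegrE//; lra.
have := bounded m; apply/negP; rewrite -ltNge.
have E : (b - x)^-1 * (b - x) = 1 by rewrite mulVf// gt_eqF.
by rewrite -E ltr_pM2r//; exact: lt_le_trans mlam.
Qed.

Lemma H_eventually_below y (j : int) : exists i : nat, H ((j - i%:Z)%:~R / q%:R) < y.
Proof.
pose t := j%:~R / q%:R : R.
exists (q * (Num.trunc (H t - y)).+1)%N.
rewrite intrB mulrBl -/t.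
have -> : (q * (Num.trunc (H t - y)).+1)%:Z%:~R / q%:R = ((Num.trunc (H t - y)).+1%:Z)%:~R :> R.
  by rewrite PoszM intrM mulrAC divff ?mul1r// gt_eqF.
rewrite -intrN srsDz// intrN; have := truncnS_gt (H t - y).
by rewrite -[(Num.trunc _).+1%:R]/((Num.trunc (H t - y)).+1%:Z%:~R); lra.
Qed.

(** Take the least [j] such that the cycle starts below [H (j / q)]. By periodicity
    all of it is then higher than the orbit of [(j - 1) / q], and [shadow_core]
    applies when [j / q + i * d] is an integer. *)
Lemma top_cycle_core y n (k : int) : (0 < n)%N -> iter n Phi y = y + k%:~R ->
  k%:~R = n%:R * d -> exists x (i : nat) (l : int),
    [/\ b <= x, x <= b' & iter i Phi y = x + l%:~R].
Proof.
move=> n0 nk kd.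
pose j0 : int := (Num.ceil y + 1) * q%:Z.
have Hj0 : y <= H (j0%:~R / q%:R).
  rewrite intrM -mulrA divff ?mulr1; last by rewrite gt_eqF.
  have -> : (Num.ceil y + 1)%:~R = 1 + (Num.ceil y)%:~R :> R by rewrite intrD addrC.
  by rewrite srsDz// -/core_end; have := ceil_ge y; facts; lra.
have [i0 low0] := H_eventually_below y j0.
have exi : exists i, H ((j0 - i%:Z)%:~R / q%:R) < y by exists i0.
have [i1 low1 i1min] := ex_minnP exi.
have i1_gt0 : (0 < i1)%N.
  by case: (i1) low1 => // ; rewrite subr0 ltNge Hj0.
pose j := j0 - i1%:Z + 1.
have up : y <= H (j%:~R / q%:R).
  have jE : j = j0 - i1.-1%:Z by rewrite /j -[in LHS](prednK i1_gt0) -addn1 PoszD; ring.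
  rewrite leNgt; apply/negP; rewrite jE => /i1min; rewrite leqNgt => /negP; apply.
  by rewrite prednK.
have low : H (j%:~R / q%:R - q%:R^-1) < y.
  move: low1; congr (H _ < y); rewrite /j intrD; field.
  by rewrite gt_eqF.
have lowi i : H (j%:~R / q%:R - q%:R^-1 + i%:R * d) < iter i Phi y.
  rewrite ltNge; apply/negP => yH.
  have iM : (i <= i.+1 * n)%N by rewrite (leq_trans (leqnSn i))// leq_pmulr.
  have := circle_iter_upper _ _ (i.+1 * n - i) yH.
  rewrite -iterD subnK// (iter_turns _ circle_mapDz _ _ _ i.+1 nk).
  have -> : j%:~R / q%:R - q%:R^-1 + i%:R * d + (i.+1 * n - i)%:R * d =
            j%:~R / q%:R - q%:R^-1 + (k * i.+1%:Z)%:~R.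
    by rewrite natrB// natrM intrM kd; ring.
  by rewrite srsDz// lerD2r leNgt low.
have [i [l jl]] := turn_solve j.
have sE : j%:~R / q%:R + i%:R * d = l%:~R.
  have qV : q%:R != 0 :> R by rewrite gt_eqF.
  apply: (@mulIf _ q%:R) => //; rewrite mulrDl divfK// -mulrA [d * _]mulrC turn_qd.
  by have := congr1 (fun z : int => z%:~R : R) jl; rewrite !(intrD, intrM).
exists (iter i Phi y - (l - 1)%:~R), i, (l - 1); split; last by rewrite subrK.
  apply: shadow_core.
    have := circle_iter_upper _ _ i up; rewrite sE.
    have -> : l%:~R = 1 + (l - 1)%:~R :> R by rewrite intrB; ring.
    by rewrite srsDz// -/core_end; lra.
  move=> m; have := lowi (m + i)%N; rewrite iterD -intrN circle_iterDz intrN.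
  have -> : j%:~R / q%:R - q%:R^-1 + (m + i)%:R * d =
            1 + m%:R * d - q%:R^-1 + (l - 1)%:~R.
    by rewrite natrD intrB -sE; ring.
  by rewrite srsDz//; lra.
have := circle_iter_upper _ _ i up; rewrite sE.
have -> : l%:~R = 1 + (l - 1)%:~R :> R by rewrite intrB; ring.
by rewrite srsDz// -/core_end; lra.
Qed.

End RationalEnd.

End CircleMap.

(** The orbits on which the map of the graph will agree with the circle map. *)
Definition live {R : realType} (Phi : R -> R) (y : R) : Prop :=
  forall i, exists k : int, k%:~R <= iter i Phi y <= k%:~R + 3/4.

(** What the construction on the graph retains from the circle map. *)
Record rotation_model {R : realType} (d : R) (P : set nat) (Phi : R -> R) : Prop := {
  rm_cont : continuous Phi;
  rm_shift : forall y (k : int), Phi (y + k%:~R) = Phi y + k%:~R;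
  rm_trap : forall y, 3/4 <= y -> y <= 1 -> Phi y = y;
  rm_gt : forall y, 0 < y -> y < 3/4 -> y < Phi y;
  rm_upper : forall y n, iter n Phi y <= y + n%:R * d + 3;
  rm_orbit : forall rho, 0 <= rho -> rho <= d -> exists y c, live Phi y /\
    forall n, `|iter n Phi y - (c + n%:R * rho)| <= 1;
  rm_unit : forall n, (0 < n)%N -> n%:R^-1 <= d -> exists2 y, live Phi y &
    iter n Phi y = y + 1;
  rm_end_sub : forall (p : int) (q : nat), (0 < q)%N -> coprime `|p| q ->
    d = p%:~R / q%:R -> forall m, P m -> exists2 y, live Phi y &
    is_period (mod1_times Phi y) (q * m);
  rm_end_sup : forall (p : int) (q : nat), (0 < q)%N -> coprime `|p| q ->
    d = p%:~R / q%:R -> forall y n (k : int) N, (0 < n)%N ->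
    iter n Phi y = y + k%:~R -> k%:~R = n%:R * d ->
    is_period (mod1_times Phi y) N -> exists2 m, P m & N = (q * m)%N
}.

Lemma rotation_model_exists {R : realType} (d : R) (P : set nat) :
  0 < d -> realisable R P -> exists Phi, rotation_model d P Phi.
Proof.
move=> d0 /(realisable_on _ _ _ (lap_end_lt d d0))[g gint gper].
have bh := core_end_le d d0; have bb := lap_end_lt d d0.
have lam2 := (lam_gt2 d d0).1.
exists (circle_map d g); split.
- exact: circle_map_cont.
- exact: circle_mapDz.
- exact: circle_map_trap.
- exact: circle_map_gt.
- exact: circle_iter_le.
- move=> rho r0 rd; exists (srs (lam d) rho 0 1), 1; split=> [i|n].
    rewrite circle_srs_iter//; have [k k1 k2] := locate_unit (1 + i%:R * rho).
    by exists k; have := srs_unit d d0 rho _ k k1 k2 r0 rd; lra.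
  rewrite circle_srs_iter//; have [k k1 k2] := locate_unit (1 + n%:R * rho).
  have /andP[] := srs_unit d d0 rho _ k k1 k2 r0 rd.
  by case: (ger0P (_ - _)); lra.
- move=> n n0 nd; have r0 : 0 <= n%:R^-1 :> R by rewrite invr_ge0.
  exists (srs (lam d) n%:R^-1 0 1).
    move=> i; rewrite circle_srs_iter//; have [k k1 k2] := locate_unit (1 + i%:R * n%:R^-1 : R).
    by exists k; have := srs_unit d d0 _ _ k k1 k2 r0 nd; lra.
  rewrite circle_srs_iter// divff ?srsD1// ?lexx ?ler01//.
  by rewrite pnatr_eq0 -lt0n.
- move=> p q q0 pq dE m; rewrite -gper => /(interval_map_periods _ _ _ _ gint)[x /andP[x0 x1] px].
  exists x; first by move=> i; exact: (core_live d d0 g gint p q q0 pq dE x i x0 x1).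
  by apply/(is_period_mul _ _ _ _ q0 (core_times d d0 g gint p q q0 pq dE x x0 x1)); exists m.
move=> p q q0 pq dE y n k N n0 nk kd py.
have [x [i [l [x0 x1 ix]]]] := top_cycle_core d d0 g gint p q q0 pq dE y n k n0 nk kd.
have : is_period (mod1_times (circle_map d g) x) N.
  apply: is_period_ext py => m.
  rewrite -(mod1_times_iter _ (circle_mapDz d g) _ _ i _ n0 nk) ix.
  by rewrite mod1_times_shift//; exact: circle_mapDz.
move=> /(is_period_mul _ _ _ _ q0 (core_times d d0 g gint p q q0 pq dE x x0 x1))[m -> pm].
by exists m => //; rewrite -gper; apply/Per_circP; exists x.
Qed.

(** * The topology of the complex plane *)

Section ComplexTopology.
Context {R : realType}.
Implicit Types z w : R[i].

Lemma Re_add z w : complex.Re (z + w) = complex.Re z + complex.Re w.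
Proof. by case: z w => [a b] [c e]. Qed.

Lemma Im_add z w : complex.Im (z + w) = complex.Im z + complex.Im w.
Proof. by case: z w => [a b] [c e]. Qed.

Lemma Re_int (k : int) : complex.Re (k%:~R : R[i]) = k%:~R.
Proof. by rewrite -(rmorph_int (real_complex R)). Qed.

Lemma Im_int (k : int) : complex.Im (k%:~R : R[i]) = 0.
Proof. by rewrite -(rmorph_int (real_complex R)). Qed.

Lemma complex_ext z w : complex.Re z = complex.Re w -> complex.Im z = complex.Im w -> z = w.
Proof. by case: z w => [a b] [c e] /= -> ->. Qed.

Lemma norm_Re_le z : `|complex.Re z|%:C <= `|z|.
Proof.
by rewrite normc_def lecR -sqrtr_sqr ler_wsqrtr// lerDl sqr_ge0.
Qed.

Lemma norm_Im_le z : `|complex.Im z|%:C <= `|z|.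
Proof.
by rewrite normc_def lecR -sqrtr_sqr ler_wsqrtr// lerDr sqr_ge0.
Qed.

Lemma norm_complex_le z : `|z| <= (`|complex.Re z| + `|complex.Im z|)%:C.
Proof.
rewrite normc_def lecR -[leRHS]ger0_norm ?addr_ge0// -sqrtr_sqr ler_wsqrtr//.
rewrite sqrrD !real_normK ?num_real// lerD2r lerDl mulrn_wge0// mulr_ge0//.
Qed.

Lemma Re_continuous : continuous (fun z : R[i] => complex.Re z).
Proof.
move=> z; apply/(@cvgrPdist_lt _ _ _ (nbhs z) (nbhs_filter z)) => e e0.
have e0' : 0 < e%:C by rewrite ltcR.
apply/nbhs_ballP; exists e%:C => //= w; rewrite -ball_normE /= => zw.
rewrite -ltcR; apply: le_lt_trans zw.
by apply: le_trans (norm_Re_le _); case: z w => [a b] [c d].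
Qed.

Lemma Im_continuous : continuous (fun z : R[i] => complex.Im z).
Proof.
move=> z; apply/(@cvgrPdist_lt _ _ _ (nbhs z) (nbhs_filter z)) => e e0.
have e0' : 0 < e%:C by rewrite ltcR.
apply/nbhs_ballP; exists e%:C => //= w; rewrite -ball_normE /= => zw.
rewrite -ltcR; apply: le_lt_trans zw.
by apply: le_trans (norm_Im_le _); case: z w => [a b] [c d].
Qed.

Lemma complex_continuous {T : topologicalType} (u v : T -> R) :
  continuous u -> continuous v -> continuous (fun x => (u x +i* v x : R[i])).
Proof.
move=> cu cv x; rewrite /continuous_at; apply/cvgrPdist_lt => e e0.
have [r r0 ->] : exists2 r : R, 0 < r & e = r%:C.
  exists (complex.Re e); first by have := e0; rewrite ltcE => /andP[_].
  by apply: complex_ext => //=; exact: ger0_Im (ltW e0).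
have r2 : 0 < r / 2 by rewrite divr_gt0.
near=> y; apply: (le_lt_trans (norm_complex_le _)); rewrite ltcR /= (splitr r).
apply: ltrD.
  by near: y; exact: (@cvgr_dist_lt _ _ _ _ _ u _ (cu x) _ r2).
by near: y; exact: (@cvgr_dist_lt _ _ _ _ _ v _ (cv x) _ r2).
Unshelve. all: by end_near.
Qed.

End ComplexTopology.

(** * Three-stars *)

(** Polar coordinates: [coord j] is the distance to the center along the arm [j],
    extended by [0] to the other arms. *)
Record star_chart {R : realType} {X : topologicalType}
    (c : X) (arm : 'I_3 -> R -> X) (coord : 'I_3 -> X -> R) : Prop := {
  sc_arm_cont : forall i, continuous (arm i);
  sc_coord_cont : forall i, continuous (coord i);
  sc_arm0 : forall i, arm i 0 = c;
  sc_coord_arm : forall i j t, 0 <= t -> t <= 1 ->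
    coord j (arm i t) = if j == i then t else 0;
  sc_cover : forall x, exists i t, [/\ 0 <= t, t <= 1 & x = arm i t]
}.

Lemma cont_three_pieces {X Y : topologicalType} (A : 'I_3 -> set X) (f : X -> Y) :
  (forall i, closed (A i)) -> \bigcup_i A i = setT ->
  (forall i, {within A i, continuous f}) -> continuous f.
Proof.
move=> cA covA cf.
pose i1 : 'I_3 := inord 1; pose i2 : 'I_3 := inord 2.
have ord3 (i : 'I_3) : [\/ i = ord0, i = i1 | i = i2].
  by case: i => [[|[|[|//]]] i3]; [apply: Or31|apply: Or32|apply: Or33];
     apply: val_inj; rewrite /= ?inordK.
have : {within A ord0 `|` A i1 `|` A i2, continuous f}.
  apply: withinU_continuous => //; first exact: closedU.
  by apply: withinU_continuous.
have -> : A ord0 `|` A i1 `|` A i2 = setT; last by move=> h; exact/continuous_subspace_setT.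
rewrite -covA; apply/seteqP; split=> [x [[]|] Ax|x [i _]].
- by exists ord0.
- by exists i1.
- by exists i2.
- by case: (ord3 i) => -> Ax; [left; left|left; right|right].
Qed.

Lemma cont_clamp_segment {R : realType} {X : topologicalType} (h : R -> X) :
  {within `[0, 1], continuous h} -> continuous (fun t => h (clamp 0 1 t)).
Proof.
move=> ch.
have hlo (t : R) : t <= 0 -> h 0 = h (clamp 0 1 t) by move=> t0; rewrite clamp_lo.
have hin (t : R) : 0 <= t <= 1 -> h t = h (clamp 0 1 t).
  by move=> /andP[t0 t1]; rewrite clamp_id.
have hhi (t : R) : 1 <= t -> h 1 = h (clamp 0 1 t) by move=> t1; rewrite clamp_hi.
pose A (i : 'I_3) : set R :=
  if nat_of_ord i is 0%N then `]-oo, 0]%classic else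
  if nat_of_ord i is 1%N then `[0, 1]%classic else `[1, +oo[%classic.
apply: (cont_three_pieces A).
- by case=> [[|[|[|//]]] i3]; rewrite /A /=; exact: interval_closed.
- apply/seteqP; split=> // t _; case: (leP t 0) => t0.
    by exists ord0 => //=; rewrite /A /= in_itv.
  case: (leP t 1) => t1.
    by exists (inord 1) => //; rewrite /A inordK//= in_itv/= ltW.
  by exists (inord 2) => //; rewrite /A inordK//= in_itv/= andbT ltW.
- case=> [[|[|[|//]]] i3]; rewrite /A /=.
  + apply: (@subspace_eq_continuous _ _ _ (fun=> h 0)).
      by move=> t; rewrite inE/= in_itv/=; exact: hlo.
    by apply: continuous_subspaceT => t; exact: cvg_cst.
  + apply: (@subspace_eq_continuous _ _ _ h) => //.
    by move=> t; rewrite inE/= in_itv/=; exact: hin.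
  + apply: (@subspace_eq_continuous _ _ _ (fun=> h 1)).
      by move=> t; rewrite inE/= in_itv/= andbT; exact: hhi.
    by apply: continuous_subspaceT => t; exact: cvg_cst.
Qed.

Lemma three_star_chart {R : realType} {X : topologicalType} :
  three_star R X -> exists c (arm : 'I_3 -> R -> X) coord, star_chart c arm coord.
Proof.
case=> hX [c [A [Aseg Acov Aint]]].
have /choice[h hP] : forall i, exists h : R -> X, exists g : X -> R,
    [/\ {within `[0, 1], continuous h}, {within A i, continuous g},
        h @` `[0, 1] = A i, {in `[0, 1], cancel h g} & h 0 = c] by exact: Aseg.
have /choice[g gP] := hP.
have hK i t : 0 <= t -> t <= 1 -> g i (h i t) = t.
  by move=> t0 t1; case: (gP i) => _ _ _ + _; apply; rewrite in_itv/= t0.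
have Ah i t : 0 <= t -> t <= 1 -> A i (h i t).
  by move=> t0 t1; case: (gP i) => _ _ <- _ _; exists t => //=; rewrite in_itv/= t0.
have h0 i : h i 0 = c by case: (gP i).
have gc i : g i c = 0 by rewrite -(h0 i) hK.
have cA i : closed (A i).
  apply: compact_closed => //; case: (gP i) => ch _ <- _ _.
  by apply: continuous_compact => //; exact: segment_compact.
pose coord i x := if x \in A i then g i x else 0.
exists c, (fun i t => h i (clamp 0 1 t)), coord; split.
- by move=> i; apply: cont_clamp_segment; case: (gP i).
- move=> i; apply: (cont_three_pieces A) => // j.
  have [->|ji] := eqVneq j i.
    apply: (@subspace_eq_continuous _ _ _ (g i)); last by case: (gP i).
    have e x : x \in A i -> g i x = coord i x by rewrite /coord => ->.
    by move=> x; exact: e.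
  apply: (@subspace_eq_continuous _ _ _ (fun=> 0)).
    have e x : x \in A j -> 0 = coord i x.
      rewrite /coord => /[!inE] xj; case: ifPn => // /[!inE] xi.
      by have : (A j `&` A i) x by []; rewrite Aint// => ->; rewrite gc.
    by move=> x; exact: e.
  by apply: continuous_subspaceT => x; exact: cvg_cst.
- by move=> i; rewrite clamp_id.
- move=> i j t t0 t1; rewrite clamp_id// /coord.
  have [->|ji] := eqVneq j i; first by rewrite mem_set ?hK//; exact: Ah.
  case: ifPn => // /[!inE] xj.
  have : (A i `&` A j) (h i t) by split=> //; exact: Ah.
  have ij : i != j by rewrite eq_sym.
  by rewrite (Aint i j ij) => ->; rewrite gc.
- move=> x; have : setT x by []; rewrite -Acov => -[i _].
  case: (gP i) => _ _ <- _ _ [t] /=; rewrite in_itv/= => /andP[t0 t1] <-.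
  by exists i, t; rewrite clamp_id.
Qed.

(** If the center moves into the arm [i], compare the coordinate along this arm of
    a point of the arm and of its image. *)
Lemma star_fixpoint {R : realType} {X : topologicalType} (c : X)
    (arm : 'I_3 -> R -> X) (coord : 'I_3 -> X -> R) (f : X -> X) :
  star_chart c arm coord -> continuous f -> exists x, f x = x.
Proof.
move=> ch cf; have [i [t [t0 t1 fc]]] := sc_cover _ _ _ ch (f c).
have [tE|t_neq0] := eqVneq t 0.
  by exists c; rewrite fc tE (sc_arm0 _ _ _ ch).
pose k r := coord i (f (arm i r)) - r.
have ck : continuous k.
  have cc := sc_coord_cont _ _ _ ch i; have ca := sc_arm_cont _ _ _ ch i.
  have cfa := cont_comp (arm i) f cf ca.
  apply: (contD (fun r => coord i (f (arm i r))) (fun r => - r)).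
    exact: (cont_comp _ _ cc cfa).
  exact: (contN _ contI).
have coord01 x : 0 <= coord i x <= 1.
  have [j [s [s0 s1 ->]]] := sc_cover _ _ _ ch x.
  by rewrite (sc_coord_arm _ _ _ ch)//; case: ifP => _; rewrite ?s0 ?lexx ?ler01.
have k0 : k 0 = t.
  by rewrite /k (sc_arm0 _ _ _ ch) fc (sc_coord_arm _ _ _ ch)// eqxx subr0.
have k1 : k 1 <= 0 by rewrite /k; have := coord01 (f (arm i 1)); lra.
have tpos : 0 < t by rewrite lt_neqAle eq_sym t_neq0.
have [|r] := @IVT R k 0 1 0 ler01 (continuous_subspaceT ck).
  by rewrite k0 (min_idPr _) ?k1 ?(max_idPl _)//=; lra.
rewrite in_itv/= => /andP[r0 r1] kr.
have rpos : 0 < r.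
  by rewrite lt_neqAle r0 andbT; apply/eqP => rE; move: kr; rewrite -rE k0; lra.
have [j [s [s0 s1 fr]]] := sc_cover _ _ _ ch (f (arm i r)).
move: kr; rewrite /k fr (sc_coord_arm _ _ _ ch)//.
case: (eqVneq i j) fr => [<-|_] fr kr; last by lra.
by exists (arm i r); rewrite fr; congr (arm i _); lra.
Qed.

(** * The map of the graph *)

Section SigmaMap.
Context {R : realType} {X : topologicalType}.
Context (c : X) (arm : 'I_3 -> R -> X) (coord : 'I_3 -> X -> R).
Hypothesis chart : star_chart c arm coord.
Context (f : X -> X) (f_cont : continuous f).
Context (d : R) (P : set nat) (Phi : R -> R).
Hypothesis model : rotation_model d P Phi.

(** The star is realised as [[-1/8, 1/8]] and the branch above [0]: these are the
    coordinates of the tips of its three arms. *)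
Definition tipx (i : 'I_3) : R :=
  if nat_of_ord i is 0%N then 1/8 else if nat_of_ord i is 1%N then - (1/8) else 0.
Definition tipy (i : 'I_3) : R := if nat_of_ord i is 2%N then 1 else 0.

Local Notation a0 := (ord0 : 'I_3).
Local Notation a1 := (@Ordinal 3 1 isT).
Local Notation a2 := (@Ordinal 3 2 isT).

Definition pt (i : 'I_3) (t : R) : R[i] := (t * tipx i) +i* (t * tipy i).

Definition embx (x : X) : R := (coord a0 x - coord a1 x) / 8.
Definition emby (x : X) : R := coord a2 x.

Lemma emb_arm i t : 0 <= t -> t <= 1 ->
  embx (arm i t) = t * tipx i /\ emby (arm i t) = t * tipy i.
Proof.
move=> t0 t1; rewrite /embx /emby !(sc_coord_arm _ _ _ chart)//.
by case: i => [[|[|[|//]]] i3]; rewrite /tipx /tipy /=; split; lra.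
Qed.

(** The image of the point at distance [r] from the center on the arm [i]. The inner
    half of the star carries a copy of [f]. Farther, the image first goes straight
    to the center, and then along the arm [i] from the center to the tip, which is
    thus a repelling fixed point: this makes the map of the star continue into a map
    of the line fixing [-1/8] and [1/8]. *)
Definition armx (i : 'I_3) (r : R) : R :=
  clamp 0 1 (3 - 4 * r) / 2 * embx (f (arm i (clamp 0 1 (2 * r))))
  + clamp 0 1 (4 * r - 3) * tipx i.
Definition army (i : 'I_3) (r : R) : R :=
  clamp 0 1 (3 - 4 * r) / 2 * emby (f (arm i (clamp 0 1 (2 * r))))
  + clamp 0 1 (4 * r - 3) * tipy i.

Lemma emb_cont : continuous embx /\ continuous emby.
Proof.
have cc j := sc_coord_cont _ _ _ chart j.
have c0 := cc a0; have c1 := cc a1; split; last exact: cc.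
by rewrite /embx; cont.
Qed.

Lemma arms_cont i : continuous (armx i) /\ continuous (army i).
Proof.
have [cx cy] := emb_cont; have ca := sc_arm_cont _ _ _ chart i.
have cf := cont_comp _ _ f_cont ca.
have cfx := cont_comp _ _ cx cf; have cfy := cont_comp _ _ cy cf.
have cl : continuous (fun r : R => clamp 0 1 (2 * r)) by cont.
have cflx := cont_comp _ _ cfx cl; have cfly := cont_comp _ _ cfy cl.
have cu : continuous (fun r : R => clamp 0 1 (3 - 4 * r) / 2) by cont.
split.
  by apply: (contD (fun r => _ * _) (fun r => _ * _)); [exact: (contM _ _ cu cflx)|cont].
by apply: (contD (fun r => _ * _) (fun r => _ * _)); [exact: (contM _ _ cu cfly)|cont].
Qed.

Lemma arms_low i r : 0 <= r -> r <= 1/2 ->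
  armx i r = embx (f (arm i (2 * r))) / 2 /\ army i r = emby (f (arm i (2 * r))) / 2.
Proof.
move=> r0 r1; rewrite /armx /army (clamp_id 0 1 (2 * r)); [|lra|lra].
by rewrite clamp_hi ?(clamp_lo 0 1 (4 * r - 3)); [split; ring|lra|lra|lra|lra].
Qed.

Lemma arms_start i r : r <= 0 -> armx i r = embx (f c) / 2 /\ army i r = emby (f c) / 2.
Proof.
move=> r0; rewrite /armx /army (clamp_lo 0 1 (2 * r)); [|lra|lra].
rewrite (sc_arm0 _ _ _ chart) clamp_hi ?(clamp_lo 0 1 (4 * r - 3)); [|lra|lra|lra|lra].
by split; ring.
Qed.

Lemma arms_end i r : 1 <= r -> armx i r = tipx i /\ army i r = tipy i.
Proof.
move=> r0; rewrite /armx /army clamp_lo ?(clamp_hi 0 1 (4 * r - 3)); [|lra|lra|lra|lra].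
by split; ring.
Qed.

Lemma arms_in i r : 0 <= r -> r <= 1 -> exists j s,
  [/\ 0 <= s, s <= Num.max (1/2) (4 * r - 3), armx i r = s * tipx j & army i r = s * tipy j].
Proof.
move=> r0 r1; have [r34|r34] := leP r (3/4).
  have [j [s [s0 s1 fs]]] := sc_cover _ _ _ chart (f (arm i (clamp 0 1 (2 * r)))).
  have [ex ey] := emb_arm j s s0 s1.
  exists j, (clamp 0 1 (3 - 4 * r) / 2 * s); rewrite /armx /army fs ex ey.
  rewrite (clamp_lo 0 1 (4 * r - 3)); [|lra|lra]; rewrite le_max.
  have : 0 <= clamp 0 1 (3 - 4 * r) <= 1 by case: clampP; lra.
  by move=> /andP[h0 h1]; split; [nra|apply/orP; left; nra|ring|ring].
exists i, (4 * r - 3); rewrite /armx /army.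
rewrite clamp_lo ?(clamp_id 0 1 (4 * r - 3)); [|lra|lra|lra|lra].
by rewrite le_max; split; [lra|apply/orP; right|ring|ring].
Qed.

(** The correction that turns the identity of [[-1/8, 1/8]] into the map of the
    star, as seen from the real axis; it vanishes farther away. *)
Definition bumpx (s : R) : R :=
  armx a0 (8 * s) + armx a1 (- (8 * s)) - armx a0 0 - clamp (- (1/8)) (1/8) s.
Definition bumpy (s : R) : R := army a0 (8 * s) + army a1 (- (8 * s)) - army a0 0.

Lemma bump_cont : continuous bumpx /\ continuous bumpy.
Proof.
have [x0 y0] := arms_cont a0; have [x1 y1] := arms_cont a1.
have c8 : continuous (fun s : R => 8 * s) by cont.
have c8' : continuous (fun s : R => - (8 * s)) by cont.
have x08 := cont_comp _ _ x0 c8; have x18 := cont_comp _ _ x1 c8'.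
have y08 := cont_comp _ _ y0 c8; have y18 := cont_comp _ _ y1 c8'.
split.
  apply: (contD (fun s => _ + _ - _) (fun s => - _)); last by cont.
  apply: (contD (fun s => _ + _) (fun s => - _)); last by cont.
  exact: (contD _ _ x08 x18).
apply: (contD (fun s => _ + _) (fun s => - _)); last by cont.
exact: (contD _ _ y08 y18).
Qed.

Lemma bump_pos s : 0 <= s -> bumpx s = armx a0 (8 * s) - clamp (- (1/8)) (1/8) s /\
  bumpy s = army a0 (8 * s).
Proof.
move=> s0; rewrite /bumpx /bumpy; have [-> ->] := arms_start a0 0 (lexx 0).
have [|-> ->] := arms_start a1 (- (8 * s)); first by lra.
by split; ring.
Qed.

Lemma bump_neg s : s <= 0 -> bumpx s = armx a1 (- (8 * s)) - clamp (- (1/8)) (1/8) s /\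
  bumpy s = army a1 (- (8 * s)).
Proof.
move=> s0; rewrite /bumpx /bumpy; have [-> ->] := arms_start a0 0 (lexx 0).
have [|-> ->] := arms_start a0 (8 * s); first by lra.
by split; ring.
Qed.

Lemma bump_far s : 1/8 <= `|s| -> bumpx s = 0 /\ bumpy s = 0.
Proof.
case: (ger0P s) => s0 s8.
  have [-> ->] := bump_pos s s0; have [|-> ->] := arms_end a0 (8 * s); first by lra.
  by rewrite clamp_hi /tipx /tipy /=; [split; lra|lra|lra].
have [-> ->] := bump_neg s (ltW s0); have [|-> ->] := arms_end a1 (- (8 * s)); first by lra.
by rewrite clamp_lo /tipx /tipy /=; [split; lra|lra|lra].
Qed.

Definition nearest (x : R) : int := Num.floor (x + 1/2).

(** The real coordinate [y] of the circle map is [x - 1/8], for which the trap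
    becomes the neighbourhood [[-1/8, 1/8]] of the integers. *)
Definition linex (x : R) : R := Phi (x - 1/8) + 1/8 + bumpx (x - (nearest x)%:~R).
Definition liney (x : R) : R := bumpy (x - (nearest x)%:~R).

Lemma periodized_cont (u : R -> R) : continuous u -> u (1/2) = 0 -> u (- (1/2)) = 0 ->
  continuous (fun x => u (x - (nearest x)%:~R)).
Proof.
move=> cu u1 u2; pose psi (k : int) (y : R) := u (y - 1/2 - k%:~R).
have cpsi : continuous (fun y : R => psi (Num.floor y) y).
  apply: cont_floor_glue => [k|k]; first by rewrite /psi; cont.
  rewrite /psi; have -> : (k + 1)%:~R - 1/2 - k%:~R = 1/2 :> R by rewrite intrD; field.
  have -> : (k + 1)%:~R - 1/2 - (k + 1)%:~R = - (1/2) :> R by field.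
  by rewrite u1 u2.
have c2 : continuous (fun x : R => x + 1/2) by cont.
have := cont_comp _ _ cpsi c2; rewrite /psi /nearest.
by under eq_fun do rewrite addrK.
Qed.

Lemma line_cont : continuous linex /\ continuous liney.
Proof.
have [bx bcy] := bump_cont.
have [|h1 h2] := bump_far (1/2); first by rewrite ger0_norm; lra.
have [|h3 h4] := bump_far (- (1/2)); first by rewrite normrN ger0_norm; lra.
have cP := rm_cont _ _ _ model.
have cp := periodized_cont _ bx h1 h3; have cq := periodized_cont _ bcy h2 h4.
split=> //; have c1 : continuous (fun x : R => Phi (x - 1/8) + 1/8) by cont.
exact: (contD _ _ c1 cp).
Qed.

(* Using [Re z] in place of an integer off the real axis makes the formula
   continuous and equivariant at once. *)
Definition sigma_map (z : R[i]) : R[i] :=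
  if complex.Im z == 0 then linex (complex.Re z) +i* liney (complex.Re z)
  else (complex.Re z + armx a2 (complex.Im z)) +i* army a2 (complex.Im z).
Local Notation F := sigma_map.

Lemma sigma_shift z (k : int) : F (z + k%:~R) = F z + k%:~R.
Proof.
have fk : nearest (complex.Re z + k%:~R) = nearest (complex.Re z) + k.
  by rewrite /nearest addrAC floorDrz ?intr_int// intrKfloor.
rewrite /sigma_map Re_add Im_add Re_int Im_int addr0; case: ifP => _.
  apply: complex_ext.
    rewrite Re_add Re_int /= /linex fk intrD.
    have -> : complex.Re z + k%:~R - 1/8 = complex.Re z - 1/8 + k%:~R by ring.
    rewrite (rm_shift _ _ _ model).
    have -> : complex.Re z + k%:~R - ((nearest (complex.Re z))%:~R + k%:~R) =
              complex.Re z - (nearest (complex.Re z))%:~R by ring.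
    by ring.
  by rewrite Im_add Im_int addr0 /= /liney fk intrD; congr bumpy; ring.
apply: complex_ext; first by rewrite Re_add Re_int /=; ring.
by rewrite Im_add Im_int addr0.
Qed.

Lemma line_near s : - (1/8) <= s -> s <= 1/8 ->
  linex s = s + bumpx s /\ liney s = bumpy s.
Proof.
move=> s0 s1; rewrite /linex /liney.
have -> : nearest s = 0 by apply: floor_def; rewrite /= ; lra.
rewrite subr0; split=> //; congr (_ + _).
have -> : s - 1/8 = s + 7/8 + (-1)%:~R by rewrite intrN; field.
rewrite (rm_shift _ _ _ model) (rm_trap _ _ _ model); [|lra|lra].
by rewrite intrN; field.
Qed.

Lemma sigma_pt i t (k : int) : 0 <= t -> t <= 1 ->
  F (pt i t + k%:~R) = (armx i t +i* army i t) + k%:~R.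
Proof.
move=> t0 t1; rewrite sigma_shift; congr (_ + _).
have s8 : 8 * (t * (1/8)) = t by field.
have F0 : F (pt a0 t) = armx a0 t +i* army a0 t.
  rewrite /sigma_map /pt /tipx /tipy /= mulr0 eqxx.
  have [||-> ->] := line_near (t * (1/8)); [lra|lra|].
  have [|-> ->] := bump_pos (t * (1/8)); first by lra.
  by rewrite clamp_id ?s8; [congr (_ +i* _); ring|lra|lra].
case: i => [[|[|[|//]]] i3].
- by rewrite (_ : Ordinal i3 = a0)//; exact: val_inj.
- rewrite (_ : Ordinal i3 = a1); last exact: val_inj.
  rewrite /sigma_map /pt /tipx /tipy /= mulr0 eqxx.
  have [||-> ->] := line_near (t * - (1/8)); [lra|lra|].
  have [|-> ->] := bump_neg (t * - (1/8)); first by lra.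
  have -> : - (8 * (t * - (1/8))) = t by field.
  by rewrite clamp_id; [congr (_ +i* _); ring|lra|lra].
- rewrite (_ : Ordinal i3 = a2); last exact: val_inj.
  have [tE|tn] := eqVneq t 0.
    rewrite tE; have [-> ->] := arms_start a2 0 (lexx 0).
    have := F0; rewrite tE; have [-> ->] := arms_start a0 0 (lexx 0).
    by rewrite /pt !mul0r.
  by rewrite /sigma_map /pt /tipx /tipy /= mulr1 (negbTE tn) mulr0 add0r.
Qed.

Lemma sigma_line (k : int) y : k%:~R <= y -> y <= k%:~R + 3/4 ->
  F (y + 1/8)%:C = (Phi y + 1/8)%:C.
Proof.
move=> ky yk; rewrite /sigma_map /= eqxx /linex /liney addrK.
have [|-> ->] := bump_far (y + 1/8 - (nearest (y + 1/8))%:~R); last by rewrite addr0.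
set l := nearest _.
have [lk|kl] := leP l k.
  by move: lk; rewrite -(ler_int R) => lk; rewrite ger0_norm; lra.
have : k%:~R + 1 <= l%:~R :> R by rewrite -[1]/(1%:~R) -intrD ler_int lezD1.
by move=> lk; rewrite ler0_norm; lra.
Qed.

(** ** Orbits in the star *)

Definition in_star (z : R[i]) : Prop := exists i t, [/\ 0 <= t, t <= 1 & z = pt i t].
Definition in_stars (z : R[i]) : Prop := exists w (k : int), in_star w /\ z = w + k%:~R.

Lemma max_arm (r : R) : r <= 1 -> Num.max (1/2) (4 * r - 3) <= 1.
Proof. by move=> r1; rewrite ge_max; apply/andP; split; lra. Qed.

Lemma in_star_map z : in_star z -> in_star (F z).
Proof.
move=> [i [t [t0 t1 ->]]]; have := sigma_pt i t 0 t0 t1; rewrite !addr0 => ->.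
have [j [s [s0 s1 -> ->]]] := arms_in i t t0 t1.
by exists j, s; split=> //; apply: le_trans s1 _; exact: max_arm.
Qed.

Lemma in_star_iter z n : in_star z -> in_star (iter n F z).
Proof. by move=> zs; elim: n => //= n; exact: in_star_map. Qed.

Lemma in_star_Re z : in_star z -> `|complex.Re z| <= 1/8.
Proof.
move=> [i [t [t0 t1 ->]]] /=; rewrite ler_norml.
by case: i => [[|[|[|//]]] i3]; rewrite /tipx /=; lra.
Qed.

Lemma in_stars_iter z n : in_stars z -> in_stars (iter n F z).
Proof.
move=> [w [k [ws ->]]]; rewrite (iterDz _ sigma_shift).
by exists (iter n F w), k; split=> //; exact: in_star_iter.
Qed.

Lemma in_stars_shift z (k : int) : in_stars (z + k%:~R) <-> in_stars z.
Proof.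
split=> -[w [l [ws]]].
  by move=> E; exists w, (l - k); split=> //; rewrite intrB addrA -E addrK.
by move=> ->; exists w, (l + k); split=> //; rewrite intrD addrA.
Qed.

(** The star is too small for a point to come back to it translated. *)
Lemma star_times z m : in_star z -> mod1_times F z m <-> fix_times F z m.
Proof.
move=> zs; split=> [[k E]|E]; last by exists 0; rewrite addr0.
have := in_star_Re _ zs; have := in_star_Re _ (in_star_iter _ m zs).
rewrite E Re_add Re_int !ler_norml => /andP[? ?] /andP[? ?].
have : k = 0.
  apply/eqP; rewrite eq_le -!ltzD1 -!(ltr_int R) !intrD; lra.
by rewrite /fix_times E => ->; rewrite addr0.
Qed.

(** The conjugacy from [f] to the map of the inner half of the star. *)
Definition half_star (x : X) : R[i] := (embx x / 2) +i* (emby x / 2).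

Lemma half_star_arm i t : 0 <= t -> t <= 1 -> half_star (arm i t) = pt i (t / 2).
Proof.
by move=> t0 t1; rewrite /half_star; have [-> ->] := emb_arm i t t0 t1;
   rewrite /pt; congr (_ +i* _); ring.
Qed.

Lemma half_star_map x : half_star (f x) = F (half_star x).
Proof.
have [i [t [t0 t1 ->]]] := sc_cover _ _ _ chart x.
rewrite half_star_arm//; have := sigma_pt i (t / 2) 0; rewrite !addr0 => ->; [|lra|lra].
have [||-> ->] := arms_low i (t / 2); [lra|lra|].
by have -> : 2 * (t / 2) = t by field.
Qed.

Lemma pt_inj i j s t : 0 <= s -> 0 <= t -> pt i s = pt j t -> s = t /\ (i = j \/ s = 0).
Proof.
move=> s0 t0 [] E1 E2.
have : s = t /\ (nat_of_ord i = j \/ s = 0).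
  case: i j E1 E2 => [[|[|[|//]]] i3] [[|[|[|//]]] j3]; rewrite /tipx /tipy /= => E1 E2;
    by split; [lra|first [left; reflexivity|right; lra]].
by move=> [-> [/val_inj ->|->]]; split=> //; [left|right].
Qed.

Lemma half_star_inj : injective half_star.
Proof.
move=> x y; have [i [s [s0 s1 ->]]] := sc_cover _ _ _ chart x.
have [j [t [t0 t1 ->]]] := sc_cover _ _ _ chart y.
rewrite !half_star_arm// => /pt_inj[||st [->|s2]]; [lra|lra| |].
  by congr (arm _ _); lra.
have -> : s = 0 by lra.
have -> : t = 0 by lra.
by rewrite !(sc_arm0 _ _ _ chart).
Qed.

Lemma half_star_in x : in_star (half_star x).
Proof.
have [i [t [t0 t1 ->]]] := sc_cover _ _ _ chart x.
by exists i, (t / 2); rewrite half_star_arm//; split=> //; lra.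
Qed.

Lemma half_star_times x m : fix_times F (half_star x) m <-> fix_times f x m.
Proof.
rewrite /fix_times -(iter_conj f F half_star x half_star_map).
by split=> [/half_star_inj|->].
Qed.

(** The distance to the center cannot increase, unless it is less than half of
    the length of the arms: no cycle meets the outer halves, except at the tips. *)
Lemma star_periods z n : in_star z -> is_period (fix_times F z) n -> Per_circ f n.
Proof.
move=> [i [t [t0 t1 zE]]] pz; have [n0 /(_ n)[_ /(_ (dvdnn n)) zn]] := pz.
have [t2|t2] := leP t (1/2).
  apply/Per_circP; exists (arm i (2 * t)); apply: is_period_ext pz => m.
  rewrite -half_star_times half_star_arm; [|lra|lra].
  have -> : 2 * t / 2 = t by field.
  by rewrite zE.
pose rad (w : R[i]) : R := 8 * `|complex.Re w| + `|complex.Im w|.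
have rad_pt j s : 0 <= s -> rad (pt j s) = s.
  move=> s0; rewrite /rad /= !normrM (ger0_norm s0).
  case: j => [[|[|[|//]]] j3]; rewrite /tipx /tipy /= ?normrN ?normr0 ?normr1 ?ger0_norm; lra.
pose V (w : R[i]) : R := if `[< in_star w >] then Num.max (1/2) (rad w) else 2.
have VF w : V (F w) <= V w.
  rewrite /V; case: (asboolP (in_star w)) => [ws|_]; last first.
    case: asboolP => // -[j [s [s0 s1 ->]]]; rewrite rad_pt// ge_max; apply/andP; split; lra.
  rewrite asboolT; last exact: in_star_map.
  have [j [s [s0 s1 wE]]] := ws; rewrite wE.
  have := sigma_pt j s 0 s0 s1; rewrite !addr0 => ->.
  have [j' [s' [s0' s1' -> ->]]] := arms_in j s s0 s1.
  rewrite -/(pt j' s') !rad_pt// ge_max le_max lexx /= le_max.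
  by move: s1'; rewrite le_max => /orP[->//|s1']; apply/orP; right; lra.
have : V (F z) = V z by apply: lyapunov_cycle n0 zn.
have zs : in_star z by exists i, t.
rewrite /V !asboolT//; last exact: in_star_map.
have Fz : F z = armx i t +i* army i t.
  by have := sigma_pt i t 0 t0 t1; rewrite !addr0 zE.
have [j [s [s0 s1 ex ey]]] := arms_in i t t0 t1.
have Fpt : F z = pt j s by rewrite Fz ex ey.
rewrite Fpt zE !rad_pt// (max_idPr (ltW t2)) => Vt.
have {}Vt : t <= Num.max (1/2) (4 * t - 3).
  by rewrite -[leLHS]Vt ge_max s1 le_max lexx.
have tE : t = 1 by move: Vt; rewrite le_max => /orP[]; lra.
have Fzz : F z = z.
  by rewrite Fz zE tE; have [-> ->] := arms_end i 1 (lexx 1); rewrite /pt !mul1r.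
rewrite (fix_times_fixed _ _ _ Fzz pz).
have [x fx] := star_fixpoint _ _ _ f chart f_cont; exact: Per_circ1 fx.
Qed.

(** ** The map on the graph *)

Lemma in_stars_real (k : int) x : k%:~R - 1/8 <= x -> x <= k%:~R + 1/8 -> in_stars x%:C.
Proof.
move=> k1 k2; have [xk|xk] := leP k%:~R x.
  exists (pt a0 (8 * (x - k%:~R))), k; split; first by exists a0, (8 * (x - k%:~R)); split=> //; lra.
  apply: complex_ext; rewrite ?Re_add ?Im_add ?Re_int ?Im_int /= /tipx /tipy /=; lra.
exists (pt a1 (8 * (k%:~R - x))), k; split; first by exists a1, (8 * (k%:~R - x)); split=> //; lra.
apply: complex_ext; rewrite ?Re_add ?Im_add ?Re_int ?Im_int /= /tipx /tipy /=; lra.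
Qed.

Lemma graph_cases z : graphS z -> in_stars z \/
  exists (k : int) y, [/\ k%:~R < y, y < k%:~R + 3/4 & z = (y + 1/8)%:C].
Proof.
case=> [zr|[[k zk] /andP[w0 w1]]]; last first.
  left; exists (pt a2 (complex.Im z)), k; split; first by exists a2, (complex.Im z).
  by apply: complex_ext; rewrite ?Re_add ?Im_add ?Re_int ?Im_int ?zk /= /tipx /tipy /=; ring.
have -> : z = (complex.Re z)%:C by apply: complex_ext.
move: (complex.Re z) => x.
pose y := x - 1/8; pose k := Num.floor y.
have ky : k%:~R <= y by exact: floor_le.
have yk : y < k%:~R + 1 by rewrite -[1]/(1%:~R) -intrD; exact: floorD1_gt.
have [y0|y0] := leP y k%:~R.
  by left; apply: (in_stars_real k); rewrite /y in ky yk y0 *; lra.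
have [y1|y1] := ltP y (k%:~R + 3/4).
  by right; exists k, y; split=> //; rewrite /y subrK.
by left; apply: (in_stars_real (k + 1)); rewrite intrD; rewrite /y in ky yk y0 y1 *; lra.
Qed.

Lemma in_stars_graph z : in_stars z -> graphS z.
Proof.
move=> [w [k [[i [t [t0 t1 ->]]] ->]]]; case: i => [[|[|[|//]]] i3].
- by left; rewrite /real_axis /= Im_add Im_int addr0 /= /tipy /= mulr0.
- by left; rewrite /real_axis /= Im_add Im_int addr0 /= /tipy /= mulr0.
- right; rewrite /branches /= Im_add Re_add Im_int Re_int /= /tipx /tipy /=; split.
    by exists k; rewrite mulr0 add0r.
  by rewrite mulr1 addr0 t0.
Qed.

Lemma sigma_graph z : graphS z -> graphS (F z).
Proof.
case/graph_cases => [/(in_stars_iter _ 1)/in_stars_graph //|[k [y [ky yk ->]]]].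
by rewrite (sigma_line k _ (ltW ky) (ltW yk)); left.
Qed.

Lemma real_axis_closed : closed (@real_axis R).
Proof.
exact: ((continuous_closedP _).1 (@Im_continuous R) _ (@closed_eq _ (0 : R))).
Qed.

Lemma branches_closed : closed (@branches R).
Proof.
(* the integers are the zeros of a continuous function *)
pose frac (x : R) : R := (x - (Num.floor x)%:~R) * ((Num.floor x + 1)%:~R - x).
have cfrac : continuous frac.
  apply: (cont_floor_glue (fun k x => (x - k%:~R) * ((k + 1)%:~R - x))).
    by move=> k; cont.
  by move=> k; rewrite !subrr mulr0 mul0r.
have cRe := @Re_continuous R; have cIm := @Im_continuous R.
have -> : @branches R = [set z : R[i] | frac (complex.Re z) = 0] `&`
    ([set z | 0 <= complex.Im z] `&` [set z | complex.Im z <= 1]).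
  apply/seteqP; split=> z /=.
    by move=> [[k kE] /andP[]]; split=> //; rewrite /frac kE intrKfloor subrr mul0r.
  case=> fz [h0 h1]; split; last by rewrite h0.
  move/eqP: fz; rewrite /frac mulf_eq0 !subr_eq0 => /orP[] /eqP E; first by exists (Num.floor (complex.Re z)).
  by exists (Num.floor (complex.Re z) + 1).
apply: closedI; last apply: closedI.
- exact: ((continuous_closedP _).1 (cont_comp _ _ cfrac cRe) _ (@closed_eq _ (0 : R))).
- exact: ((continuous_closedP _).1 cIm _ (@closed_ge _ (0 : R))).
- exact: ((continuous_closedP _).1 cIm _ (@closed_le _ (1 : R))).
Qed.

Lemma sigma_continuous : {within @graphS R, continuous F}.
Proof.
have cRe := @Re_continuous R; have cIm := @Im_continuous R.
have [lx ly] := line_cont; have [cx cy] := arms_cont a2.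
apply: withinU_continuous; [exact: real_axis_closed|exact: branches_closed| |].
  have FE z : z \in @real_axis R ->
      linex (complex.Re z) +i* liney (complex.Re z) = F z.
    by rewrite inE /real_axis /= /sigma_map => ->; rewrite eqxx.
  apply: (@subspace_eq_continuous _ _ _ (fun z : R[i] => linex (complex.Re z) +i* liney (complex.Re z) : R[i])).
    by move=> z; exact: FE.
  apply: continuous_subspaceT; apply: complex_continuous.
    exact: (cont_comp _ _ lx cRe).
  exact: (cont_comp _ _ ly cRe).
have FE z : z \in @branches R ->
    (complex.Re z + armx a2 (complex.Im z)) +i* army a2 (complex.Im z) = F z.
  case: z => x w /[!inE] -[[k /= ->] /= /andP[w0 w1]].
  have := sigma_pt a2 w k w0 w1.
  have -> : pt a2 w + k%:~R = k%:~R +i* w.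
    by apply: complex_ext; rewrite ?Re_add ?Im_add ?Re_int ?Im_int /= /tipx /tipy /=; ring.
  by move=> ->; apply: complex_ext; rewrite ?Re_add ?Im_add ?Re_int ?Im_int /=; ring.
apply: (@subspace_eq_continuous _ _ _ (fun z : R[i] =>
    (complex.Re z + armx a2 (complex.Im z)) +i* army a2 (complex.Im z) : R[i])).
  by move=> z; exact: FE.
apply: continuous_subspaceT; apply: complex_continuous.
  exact: (contD _ _ cRe (cont_comp _ _ cx cIm)).
exact: (cont_comp _ _ cy cIm).
Qed.

Lemma sigma_L1 : L1 F.
Proof.
split; [exact: sigma_continuous|exact: sigma_graph|].
by move=> z _; have := sigma_shift z 1.
Qed.

(** ** Orbits that avoid the stars *)

Lemma live_orbit y n : live Phi y -> iter n F (y + 1/8)%:C = (iter n Phi y + 1/8)%:C.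
Proof.
move=> ly; elim: n => // n IH; rewrite !iterS IH.
by have [k /andP[k1 k2]] := ly n; exact: (sigma_line k).
Qed.

Lemma live_times y m : live Phi y ->
  mod1_times F (y + 1/8)%:C m <-> mod1_times Phi y m.
Proof.
move=> ly; rewrite /mod1_times live_orbit//; split=> -[k E]; exists k.
  by have := congr1 (fun z : R[i] => complex.Re z) E; rewrite /= Re_add Re_int /=; lra.
by rewrite E; apply: complex_ext; rewrite ?Re_add ?Im_add ?Re_int ?Im_int /=; ring.
Qed.

(** A point of the graph off the stars is real, and an orbit that enters the stars
    stays in one of them. *)
Lemma orbit_cases z : graphS z -> (exists N, in_stars (iter N F z)) \/
  exists y, [/\ z = (y + 1/8)%:C, live Phi y & forall n, iter n Phi y < iter n.+1 Phi y].
Proof.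
move=> gz; have [|noN] := pselect (exists N, in_stars (iter N F z)); first by left.
right; have gn n : graphS (iter n F z) by elim: n => //= n; exact: sigma_graph.
have away n : exists (k : int) y, [/\ k%:~R < y, y < k%:~R + 3/4 & iter n F z = (y + 1/8)%:C].
  by case: (graph_cases _ (gn n)) => // ns; case: noN; exists n.
have [k0 [y [_ _ zE]]] := away 0%N.
exists y; suff orb n : iter n F z = (iter n Phi y + 1/8)%:C /\
    exists k : int, k%:~R < iter n Phi y /\ iter n Phi y < k%:~R + 3/4.
  split=> // n; first by have [_ [k [? ?]]] := orb n; exists k; lra.
  have [_ [k [y1 y2]]] := orb n; rewrite iterS.
  have := rm_gt _ _ _ model (iter n Phi y - k%:~R).
  by rewrite -intrN (rm_shift _ _ _ model) intrN; lra.
elim: n => [|n [IH [k [y1 y2]]]].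
  have [k [y' [y1 y2]]] := away 0%N; rewrite zE => E; split=> //.
  have /= yy := congr1 (fun z : R[i] => complex.Re z) E.
  by exists k; split => /=; lra.
have E : iter n.+1 F z = (iter n.+1 Phi y + 1/8)%:C.
  by rewrite !iterS IH; exact: (sigma_line k _ (ltW y1) (ltW y2)).
split=> //; have [l [y' [l1 l2]]] := away n.+1; rewrite E => E'.
have /= yy := congr1 (fun z : R[i] => complex.Re z) E'.
by exists l; rewrite /=; split; lra.
Qed.

End SigmaMap.

(** * Rotation numbers *)

Lemma cvg_slope {R : realType} (u : nat -> R) (rho C : R) (N : nat) :
  (forall n, (N <= n)%N -> `|u n - n%:R * rho| <= C) ->
  (fun n => u n / n%:R) @ \oo --> rho.
Proof.
move=> uC; apply/cvgrPdist_lt => e e0.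
have C0 : 0 <= C by apply: le_trans (uC N (leqnn N)).
near=> n.
have n1 : (0 < n)%N by near: n; exact: nbhs_infty_ge.
have nr : 0 < n%:R :> R by rewrite ltr0n.
have nN : (N <= n)%N by near: n; exact: nbhs_infty_ge.
have nC : C / e + 1 <= n%:R by near: n; exact: nbhs_infty_ger.
have -> : rho - u n / n%:R = - ((u n - n%:R * rho) / n%:R) by field; rewrite gt_eqF.
rewrite normrN normrM normfV (ger0_norm (ltW nr)) ltr_pdivrMr//.
apply: le_lt_trans (uC n nN) _.
have CE : C / e * e = C by rewrite divfK// gt_eqF.
by nra.
Unshelve. all: by end_near.
Qed.

Lemma slope_le {R : realType} (u : nat -> R) (rho d C : R) :
  (fun n => u n / n%:R) @ \oo --> rho -> (forall n, u n <= n%:R * d + C) -> rho <= d.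
Proof.
move=> cu ud; have cd : (fun n : nat => (n%:R * d + C) / n%:R) @ \oo --> d.
  by apply: (cvg_slope _ _ `|C| 0) => n _; rewrite addrAC subrr add0r.
apply: (ler_cvg_to cu cd); apply: nearW => n.
by rewrite ler_wpM2r// invr_ge0.
Qed.

Lemma rotation_unique {R : realType} (F : R[i] -> R[i]) z rho rho' :
  rotation_number F z rho -> rotation_number F z rho' -> rho = rho'.
Proof. by move=> h1 h2; exact: (cvg_unique _ h1 h2). Qed.

Lemma period_mod1P {R : realType} (F : R[i] -> R[i]) z n :
  (forall w (k : int), F (w + k%:~R) = F w + k%:~R) ->
  period_mod1 F z n <-> is_period (mod1_times F z) n.
Proof.
move=> Fk; rewrite (least_is_period _ _ (mod1_monoid F Fk z)); split.
  by move=> [[n0 Fn] nmin]; split=> // m m0 Fm; apply: nmin; split.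
by move=> [n0 Fn nmin]; split; [split|move=> m [m0 Fm]; exact: nmin].
Qed.

Lemma period_exists (A : nat -> Prop) n : return_monoid A -> (0 < n)%N -> A n ->
  exists m, is_period A m.
Proof.
move=> Am n0 An; have ex : exists m, (0 < m)%N && `[< A m >].
  by exists n; rewrite n0 asboolT.
have [m /andP[m0 /asboolP Amm] mmin] := ex_minnP ex.
exists m; apply/least_is_period => //; split=> // k k0 Ak.
by apply: mmin; rewrite k0 asboolT.
Qed.

(** Running [j] times through a cycle makes a number of turns divisible by [j]. *)
Lemma one_turn_period {V : nzRingType} (F : V -> V) (y : V) n :
  injective (fun k : int => k%:~R : V) ->
  (forall z (k : int), F (z + k%:~R) = F z + k%:~R) ->
  (0 < n)%N -> iter n F y = y + 1 -> is_period (mod1_times F y) n.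
Proof.
move=> Vinj Fk n0 ny; have An : mod1_times F y n by exists 1.
have [m pm] := period_exists _ _ (mod1_monoid F Fk y) n0 An.
have [m0 mA] := pm; have /dvdnP[j nE] := (mA n).1 An.
have [k mk] := (mA m).2 (dvdnn m).
have := iter_turns F Fk _ _ _ j mk; rewrite -nE ny => /addrI /(Vinj 1) /(congr1 absz).
rewrite abszM absz_nat => /esym/eqP; rewrite muln_eq1 => /andP[_ /eqP j1].
by rewrite nE j1 mul1n.
Qed.

Section PositiveRotation.
Context {R : realType} {X : topologicalType}.
Context (c : X) (arm : 'I_3 -> R -> X) (coord : 'I_3 -> X -> R).
Hypothesis chart : star_chart c arm coord.
Context (f : X -> X) (f_cont : continuous f).
Context (d : R) (P : set nat) (Phi : R -> R).
Hypothesis d_gt0 : 0 < d.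
Hypothesis model : rotation_model d P Phi.
Local Notation F := (sigma_map arm coord f Phi).

Let F_shift := sigma_shift arm coord f d P Phi model.
Let liveO := live_orbit c arm coord chart f Phi.
Let liveT := live_times c arm coord chart f Phi.

Lemma stars_rotation z N : in_stars (iter N F z) -> rotation_number F z 0.
Proof.
move=> [w [k [ws E]]].
pose C := `|k%:~R - complex.Re z| + 1/8.
apply: (cvg_slope _ _ C N) => n Nn; rewrite mulr0 subr0.
rewrite -(subnK Nn) iterD E (iterDz _ F_shift) Re_add Re_int.
have := in_star_Re _ (in_star_iter c arm coord chart f d P Phi model _ (n - N) ws).
have -> : complex.Re (iter (n - N) F w) + k%:~R - complex.Re z =
          (k%:~R - complex.Re z) + complex.Re (iter (n - N) F w) by ring.
by move=> h; apply: le_trans (ler_normD _ _) _; rewrite lerD2l.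
Qed.

Lemma live_gt y n : (forall n, iter n Phi y < iter n.+1 Phi y) -> (0 < n)%N -> y < iter n Phi y.
Proof.
move=> inc; elim: n => // -[|n] IH _; first exact: (inc 0%N).
exact: lt_trans (IH isT) (inc n.+1).
Qed.

Lemma sigma_Rot : Rot F `<=` `[0, d]%classic.
Proof.
move=> rho [z gz rz]; rewrite /= in_itv /=.
have [[N zN]|[y [zE ly inc]]] := orbit_cases c arm coord chart f d P Phi model z gz.
  by rewrite (rotation_unique _ _ _ _ rz (stars_rotation _ _ zN)) lexx ltW.
have uE n : complex.Re (iter n F z) - complex.Re z = iter n Phi y - y.
  by rewrite zE liveO//=; ring.
move: rz; rewrite /rotation_number.
under eq_fun do rewrite uE; move=> rz; apply/andP; split; last first.
  by apply: (slope_le _ _ _ 3 rz) => n; have := rm_upper _ _ _ model y n; lra.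
have : - rho <= 0.
  apply: (slope_le (fun n => - (iter n Phi y - y)) _ _ 0).
    by under eq_fun do rewrite mulNr; exact: cvgN.
  move=> [|n]; first by rewrite /= subrr oppr0 mul0r add0r.
  by have := live_gt y n.+1 inc isT; rewrite mulr0 add0r; lra.
by lra.
Qed.

Lemma sigma_Rot_R : `[0, d]%classic `<=` Rot_R F.
Proof.
move=> rho; rewrite /= in_itv /= => /andP[r0 rd].
have [y [c' [ly yc]]] := rm_orbit _ _ _ model rho r0 rd.
exists (y + 1/8)%:C => //; apply: (cvg_slope _ _ (1 + `|c' - y|) 0) => n _.
rewrite liveO//=.
have -> : iter n Phi y + 1/8 - (y + 1/8) - n%:R * rho =
  (iter n Phi y - (c' + n%:R * rho)) + (c' - y) by ring.
by apply: le_trans (ler_normD _ _) _; rewrite lerD2r.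
Qed.

Lemma Rot_R_sub (G : R[i] -> R[i]) : Rot_R G `<=` Rot G.
Proof. by move=> rho [z zr rz]; exists z => //; left. Qed.

Lemma sigma_Rot_eq : Rot F = `[0, d]%classic /\ Rot_R F = Rot F.
Proof.
have E : Rot F = `[0, d]%classic.
  apply/seteqP; split; first exact: sigma_Rot.
  by move=> rho /sigma_Rot_R/Rot_R_sub.
by split=> //; apply/seteqP; split; [exact: Rot_R_sub|rewrite E; exact: sigma_Rot_R].
Qed.

(** Off the stars the circle map advances, hence the positive number of turns. *)
Lemma periodic_cases z n : graphS z -> is_period (mod1_times F z) n ->
  (Per_circ f n /\ rotation_number F z 0) \/
  exists y (k : int), [/\ is_period (mod1_times Phi y) n,
    iter n Phi y = y + k%:~R, 0 < k & rotation_number F z (k%:~R / n%:R)].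
Proof.
move=> gz pz; have [n0 pn] := pz; have [k zk] := (pn n).2 (dvdnn n).
have [[N zN]|[y [zE ly inc]]] := orbit_cases c arm coord chart f d P Phi model z gz.
  left; split; last exact: stars_rotation zN.
  have : in_stars (iter (N * n) F z).
    rewrite -(subnK (leq_pmulr N n0)) iterD.
    exact: (in_stars_iter c arm coord chart f d P Phi model).
  rewrite (iter_turns _ F_shift _ _ _ N zk) => /in_stars_shift[w [l [ws E]]].
  apply: (star_periods c arm coord chart f f_cont d P Phi model w) => //.
  apply: is_period_ext pz => m; rewrite E (mod1_times_shift _ F_shift).
  exact: (star_times c arm coord chart f d P Phi model).
right; exists y, k.
have yt m := liveT y m ly.
have yk : iter n Phi y = y + k%:~R.
  have := congr1 (fun z : R[i] => complex.Re z) zk.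
  by rewrite zE liveO// Re_add Re_int /=; lra.
have kpos : 0 < k.
  by rewrite -(ltr_int R); have := live_gt y n inc n0; rewrite yk; lra.
split=> //; first by apply: is_period_ext pz => m; rewrite zE yt.
(* the displacement is exact after whole periods, and less than one period remains *)
pose C := \sum_(i < n) `|iter i Phi y - y| + k%:~R.
apply: (cvg_slope _ _ C 0) => m _.
rewrite zE !liveO//=.
rewrite {1 2}(divn_eq m n) addnC iterD.
rewrite (iter_turns _ (rm_shift _ _ _ model) _ _ _ (m %/ n) yk).
rewrite (iterDz _ (rm_shift _ _ _ model)) natrD natrM intrM.
have nr : 0 < n%:R :> R by rewrite ltr0n.
set r := (m %% n)%N; set q := (m %/ n)%N.
have -> : iter r Phi y + k%:~R * q%:Z%:~R + 1/8 - (y + 1/8) -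
    (r%:R + q%:R * n%:R) * (k%:~R / n%:R) = (iter r Phi y - y) - r%:R * (k%:~R / n%:R).
  by rewrite -[q%:Z%:~R]/(q%:R); field; rewrite gt_eqF.
have rn : (r < n)%N by rewrite ltn_mod.
apply: le_trans (ler_normB _ _) _; rewrite /C lerD//.
  rewrite (bigD1 (Ordinal rn))//= lerDl; exact: sumr_ge0.
have k0 : 0 <= k%:~R :> R by rewrite ler0z ltW.
rewrite ger0_norm ?mulr_ge0 ?invr_ge0//.
rewrite mulrCA ler_piMr// ler_pdivrMr// mul1r ler_nat; exact: ltnW.
Qed.

Lemma half_star_period n : Per_circ f n -> exists z,
  [/\ graphS z, rotation_number F z 0 & is_period (mod1_times F z) n].
Proof.
move=> /Per_circP[x px]; exists (half_star coord x).
have hs := half_star_in c arm coord chart x.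
have hss : in_stars (half_star coord x) by exists (half_star coord x), 0; rewrite addr0.
split; first exact: in_stars_graph.
  exact: (stars_rotation _ 0).
apply: is_period_ext px => m.
rewrite (star_times c arm coord chart f d P Phi model _ m hs).
by rewrite (half_star_times c arm coord chart f d P Phi model).
Qed.

Lemma sigma_Per_rot0 : Per_rot 0 F = Per_circ f.
Proof.
apply/seteqP; split=> n; last first.
  by move=> /half_star_period[z [gz rz pz]]; exists z; split=> //; apply/period_mod1P.
move=> [z [gz rz /(period_mod1P _ _ _ F_shift) pz]].
have [[]//|[y [k [_ _ k0 rk]]]] := periodic_cases z n gz pz.
have := rotation_unique _ _ _ _ rz rk => /esym/eqP; rewrite mulf_eq0 invr_eq0.
by rewrite intr_eq0 pnatr_eq0 (gt_eqF k0) /= => /eqP n0; case: pz; rewrite n0.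
Qed.

Lemma reduce_fraction (k : int) n : (0 < n)%N -> exists (p : int) (q : nat),
  [/\ (0 < q)%N, coprime `|p| q & k%:~R / n%:R = p%:~R / q%:R :> R].
Proof.
move=> n0; pose g := gcdn `|k| n.
have g0 : (0 < g)%N by rewrite gcdn_gt0 n0 orbT.
have /dvdnP[q nE] : (g %| n)%N by exact: dvdn_gcdr.
have /dvdzP[p kE] : (g%:Z %| k)%Z by rewrite dvdzE /=; exact: dvdn_gcdl.
have q0 : (0 < q)%N by move: n0; rewrite nE muln_gt0 => /andP[].
exists p, q; split=> //.
  have kabs : `|k|%N = (`|p| * g)%N by rewrite kE abszM.
  have : gcdn `|k| n = g by [].
  rewrite kabs nE -muln_gcdl => /eqP; rewrite -[X in _ == X]mul1n eqn_pmul2r//.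
have gr : g%:R != 0 :> R by rewrite pnatr_eq0 -lt0n.
have qr : q%:R != 0 :> R by rewrite pnatr_eq0 -lt0n.
rewrite kE nE intrM natrM -[g%:Z%:~R]/(g%:R).
by field; apply/andP.
Qed.

Lemma sigma_Per : Per F = Per_circ f `|` M 0 d `|` Lambda d P.
Proof.
apply/seteqP; split=> n.
  move=> [z gz /(period_mod1P _ _ _ F_shift) pz].
  have [[]|[y [k [py yk k0 rk]]]] := periodic_cases z n gz pz; first by left; left.
  have [n0 _] := py; have nr : 0 < n%:R :> R by rewrite ltr0n.
  have : k%:~R / n%:R <= d.
    have : Rot F (k%:~R / n%:R) by exists z.
    by move/sigma_Rot; rewrite /= in_itv/= => /andP[].
  rewrite le_eqVlt => /orP[/eqP dE|kd]; last first.
    left; right; split=> //; exists k; rewrite kd andbT.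
    by rewrite divr_gt0// ltr0z.
  right; have [p [q [q0 pq E]]] := reduce_fraction k n n0.
  have dpq : d = p%:~R / q%:R by rewrite -dE.
  have [|m Pm ->] := rm_end_sup _ _ _ model p q q0 pq dpq y n k n n0 yk _ py.
    by rewrite -dE mulrC divfK// gt_eqF.
  by exists p, q; split=> //; exists m.
have perF y : live Phi y -> is_period (mod1_times Phi y) n -> Per F n.
  move=> ly py; exists (y + 1/8)%:C; first by left.
  apply/(period_mod1P _ _ _ F_shift); apply: is_period_ext py => m.
  by rewrite liveT.
move=> [[/half_star_period[z [gz _ pz]]|[n0 [k /andP[k0 kd]]]]|].
- by exists z => //; apply/period_mod1P.
- have nr : 0 < n%:R :> R by rewrite ltr0n.
  have [|y ly yn] := rm_unit _ _ _ model n n0.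
    have k1 : 1 <= k%:~R :> R.
      have : (0 < k)%R by rewrite -(ltr0z R); move: k0; rewrite pmulr_lgt0// invr_gt0.
      by rewrite gtz0_ge1 -(ler_int R).
    by apply: le_trans (ltW kd); rewrite ler_peMl// invr_ge0.
  apply: (perF y ly); apply: one_turn_period => //.
    exact: intr_inj.
  exact: rm_shift model.
- move=> [p [q [q0 pq dE [m Pm nE]]]].
  have [y ly py] := rm_end_sub _ _ _ model p q q0 pq dE m Pm.
  by apply: (perF y ly); rewrite nE.
Qed.

End PositiveRotation.

(** * Reflection in the imaginary axis *)

Section Reflection.
Context {R : realType}.

Definition reflect_re (z : R[i]) : R[i] := (- complex.Re z) +i* complex.Im z.
Local Notation sg := reflect_re.

Lemma reflect_reK : involutive sg.
Proof. by move=> [x y]; rewrite /reflect_re /= opprK. Qed.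

Lemma reflect_reD z w : sg (z + w) = sg z + sg w.
Proof.
by apply: complex_ext; rewrite ?Re_add ?Im_add /= ?Re_add ?Im_add ?opprD.
Qed.

Lemma reflect_re_int (k : int) : sg k%:~R = (- k)%:~R.
Proof.
by apply: complex_ext; rewrite /= ?Re_int ?Im_int ?intrN.
Qed.

Lemma reflect_re_graph z : graphS z -> graphS (sg z).
Proof.
case=> [zr|[[k zk] zi]]; [by left|right; split=> //].
by exists (- k); rewrite /= zk intrN.
Qed.

Lemma reflect_re_cont : continuous sg.
Proof.
have cRe := @Re_continuous R; have cIm := @Im_continuous R.
exact: (complex_continuous _ _ (contN _ cRe) cIm).
Qed.

Context (F : R[i] -> R[i]).
Let G z := sg (F (sg z)).

Lemma reflect_iter n z : iter n G z = sg (iter n F (sg z)).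
Proof. by elim: n => [|n IH] /=; rewrite ?reflect_reK// IH /G reflect_reK. Qed.

Lemma reflect_L1 : L1 F -> L1 G.
Proof.
case=> /subspace_continuousP cF FS F1; split.
- apply/subspace_continuousP => z zS.
  apply: (@cvg_comp _ _ _ (fun w => F (sg w)) sg _ (nbhs (F (sg z)))); last exact: reflect_re_cont.
  apply: (@cvg_comp _ _ _ sg F _ (within (@graphS R) (nbhs (sg z)))).
    move=> U; rewrite /within /= => zU.
    have : nbhs z (sg @^-1` [set w | graphS w -> U w]) := reflect_re_cont z _ zU.
    apply: (@filterS _ _ (nbhs_filter z)) => w wU wS.
    by apply: wU; exact: reflect_re_graph.
  by apply: cF; exact: reflect_re_graph.
- by move=> z zS; apply/reflect_re_graph/FS/reflect_re_graph.
move=> z zS; rewrite /G reflect_reD (reflect_re_int 1).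
have zS' : graphS (sg z + (-1)%:~R).
  rewrite -(reflect_re_int 1) -reflect_reD; apply: reflect_re_graph.
  case: zS => [zr|[[k zk] zi]]; [left|right; split=> //].
  - by rewrite /real_axis /= Im_add Im_int addr0.
  - by exists (k + 1); rewrite Re_add Re_int zk intrD.
  - by rewrite Im_add Im_int addr0.
have := F1 _ zS'; rewrite -addrA -[1]/(1%:~R) -intrD addNr addr0 => ->.
by rewrite reflect_reD (reflect_re_int 1) -addrA -intrD addNr addr0.
Qed.

Lemma reflect_rotation z rho : rotation_number G z rho <-> rotation_number F (sg z) (- rho).
Proof.
rewrite /rotation_number.
have E n : (complex.Re (iter n G z) - complex.Re z) / n%:R =
    - ((complex.Re (iter n F (sg z)) - complex.Re (sg z)) / n%:R).
  by rewrite reflect_iter -[RHS]mulNr; congr (_ * _); rewrite /=; ring.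
rewrite (funext E); set u := (X in _ <-> X @ _ --> _).
split=> cu; last by rewrite -(opprK rho); exact: cvgN.
have -> : u = (fun n => - - u n) by apply/funext => n; rewrite opprK.
exact: cvgN.
Qed.

Lemma reflect_returns z n : returns_mod1 G z n <-> returns_mod1 F (sg z) n.
Proof.
rewrite /returns_mod1 reflect_iter; split=> -[n0 [k E]]; split=> //; exists (- k).
  by rewrite -reflect_re_int -reflect_reD -E reflect_reK.
by rewrite E reflect_reD reflect_reK reflect_re_int.
Qed.

Lemma reflect_period z n : period_mod1 G z n <-> period_mod1 F (sg z) n.
Proof.
by split=> -[/reflect_returns r m]; split=> // k /reflect_returns; exact: m.
Qed.

Lemma reflect_Per : Per G = Per F.
Proof.
apply/seteqP; split=> n [z zS].
  by move=> /reflect_period pz; exists (sg z) => //; exact: reflect_re_graph.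
move=> pz; exists (sg z); first exact: reflect_re_graph.
by apply/reflect_period; rewrite reflect_reK.
Qed.

Lemma reflect_Per_rot0 : Per_rot 0 G = Per_rot 0 F.
Proof.
apply/seteqP; split=> n [z [zS rz]].
  move: rz => /reflect_rotation; rewrite oppr0 => rz /reflect_period pz.
  by exists (sg z); split=> //; exact: reflect_re_graph.
move=> pz; exists (sg z); split; first exact: reflect_re_graph.
  by apply/reflect_rotation; rewrite oppr0 reflect_reK.
by apply/reflect_period; rewrite reflect_reK.
Qed.

Lemma reflect_Rot rho : Rot G rho <-> Rot F (- rho).
Proof.
split=> -[z zS rz]; exists (sg z); try exact: reflect_re_graph.
  exact/reflect_rotation.
by apply/reflect_rotation; rewrite reflect_reK.
Qed.

Lemma reflect_Rot_R rho : Rot_R G rho <-> Rot_R F (- rho).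
Proof.
split=> -[z zS rz]; exists (sg z) => //.
  exact/reflect_rotation.
by apply/reflect_rotation; rewrite reflect_reK.
Qed.

Lemma M_opp (a b : R) : M (- b) (- a) = M a b.
Proof.
apply/seteqP; split=> n [n0 [k /andP[h1 h2]]]; split=> //; exists (- k);
  by rewrite intrN mulNr; apply/andP; split; lra.
Qed.

Lemma Lambda_opp (rho : R) A : Lambda (- rho) A = Lambda rho A.
Proof.
apply/seteqP; split=> m [k [n [n0 kn E q]]]; exists (- k), n; split=> //;
  by rewrite ?abszN// intrN mulNr -E ?opprK.
Qed.

End Reflection.

Lemma sigma_map_exists {R : realType} (d : R) (P : set nat) (X : topologicalType)
    (f : X -> X) : 0 < d -> realisable R P -> three_star R X -> continuous f ->
  exists F : R[i] -> R[i], [/\ L1 F, Rot_R F = Rot F, Rot F = `[0, d]%classic,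
    Per_rot 0 F = Per_circ f & Per F = Per_circ f `|` M 0 d `|` Lambda d P].
Proof.
move=> d0 /(rotation_model_exists d P d0)[Phi model].
move=> /three_star_chart[c [arm [coord chart]]] cf.
exists (sigma_map arm coord f Phi).
have [E1 E2] := sigma_Rot_eq c arm coord chart f d P Phi d0 model.
split=> //.
- exact: (sigma_L1 c arm coord chart f cf d P Phi model).
- exact: (sigma_Per_rot0 c arm coord chart f cf d P Phi model).
- exact: (sigma_Per c arm coord chart f cf d P Phi d0 model).
Qed.

Theorem theorem3 (R : realType) (d : R) (d_neq0 : d != 0) (s_d : NSh)
    (X3 : topologicalType) (X3_star : three_star R X3)
    (f : X3 -> X3) (f_cont : continuous f) :
  exists F : R[i] -> R[i],
    [/\ L1 F,
        Rot_R F = Rot F,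
        Rot F = `[Num.min 0 d, Num.max 0 d]%classic,
        Per_rot 0 F = Per_circ f
      & Per F = Per_circ f `|` M (Num.min 0 d) (Num.max 0 d)
                  `|` Lambda d (Sh s_d)].
Proof.
have rS := @realisable_Sh R s_d.
have [d0|d0|dE] := ltgtP d 0; last by rewrite dE eqxx in d_neq0.
  have d1 : 0 < - d by rewrite oppr_gt0.
  have [F [FL FR Fd F0 FP]] := sigma_map_exists (- d) _ _ f d1 rS X3_star f_cont.
  exists (fun z => reflect_re (F (reflect_re z))); split.
  - exact: reflect_L1.
  - by apply/seteqP; split=> rho; rewrite reflect_Rot reflect_Rot_R FR.
  - apply/seteqP; split=> rho; rewrite reflect_Rot Fd /= !in_itv/=; lra.
  - by rewrite reflect_Per_rot0.
  - by rewrite reflect_Per FP Lambda_opp -[in LHS]oppr0 M_opp.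
have [F HF] := sigma_map_exists d _ _ f d0 rS X3_star f_cont.
by exists F.
Qed.
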